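(* Let $n\in\mathbb N$, and let $\varphi:\mathbb R\to\mathbb R$ be continuous and nonconstant such that the limits $\varphi(-\infty):=\lim_{x\to-\infty}\varphi(x)$ and $\varphi(\infty):=\lim_{x\to\infty}\varphi(x)$ exist and are finite. (1) If $\varphi(-\infty)=\varphi(\infty)$, then $\overline{\mathcal N_\varphi^1(\mathbb R^n)}=\overline{\mathcal N_\varphi^\infty(\mathbb R^n)}$ and $$\overline{\mathcal N_\varphi^\infty(\mathbb R^n)}=\overline{\operatorname{span}}\left\{x\mapsto g(P(x))\ \middle|\ k\in\mathbb Z_{\ge0},\ P:\mathbb R^n\to\mathbb R^k\text{ linear},\ g\in C_0(\mathbb R^k)\right\}.$$ (2) If $\varphi(-\infty)\ne\varphi(\infty)$, then $\overline{\mathcal N_\varphi^2(\mathbb R^n)}=\overline{\mathcal N_\varphi^\infty(\mathbb R^n)}$ and $$\overline{\mathcal N_\varphi^\infty(\mathbb R^n)}=\overline{\operatorname{span}}\left\{x\mapsto\prod_{j=1}^m\tanh(a_j\cdot x)\ \middle|\ m\in\mathbb Z_{\ge0},\ a_1,\ldots,a_m\in\mathbb R^n\right\}.$$ If, moreover, $n\ge2$, then $\overline{\mathcal N_\varphi^1(\mathbb R^n)}\ne\overline{\mathcal N_\varphi^2(\mathbb R^n)}$.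
   Context: $\mathbb N=\{1,2,\ldots\}$. $C_0(\mathbb R^k)$ is the space of continuous functions $f:\mathbb R^k\to\mathbb R$ with $\lim_{\|x\|\to\infty}f(x)=0$; for $k=0$, $\mathbb R^0$ is a point and $C_0(\mathbb R^0)=\mathbb R$. The empty product ($m=0$) is the constant function $1$. For a function $\varphi:\mathbb R\to\mathbb R$ define the real vector spaces of functions $\mathbb R^n\to\mathbb R$ $$\mathcal N_\varphi^1(\mathbb R^n):=\operatorname{span}\{x\mapsto\varphi(a\cdot x+b)\mid a\in\mathbb R^n,\ b\in\mathbb R\},$$ recursively for $l\ge2$, $$\mathcal N_\varphi^l(\mathbb R^n):=\operatorname{span}\{x\mapsto\varphi(f(x)+b)\mid f\in\mathcal N_\varphi^{l-1}(\mathbb R^n),\ b\in\mathbb R\},$$ and $\mathcal N_\varphi^\infty(\mathbb R^n):=\bigcup_{l\ge1}\mathcal N_\varphi^l(\mathbb R^n)$; here span is the $\mathbb R$-linear span and $a\cdot x$ is the Euclidean inner product. For a set $S$ of functions $\mathbb R^n\to\mathbb R$, $\overline S$ is its uniform closure (closure with respect to the supremum norm over $\mathbb R^n$), and $\overline{\operatorname{span}}\,S:=\overline{\operatorname{span}S}$. *)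

(* Defs.v *)
From HB Require Import structures.
From mathcomp Require Import all_boot all_order all_algebra.
From mathcomp Require Import all_classical all_reals all_analysis.
Set Implicit Arguments.
Unset Strict Implicit.
Unset Printing Implicit Defensive.
Import Order.TTheory GRing.Theory Num.Theory.
Import numFieldNormedType.Exports.
Local Open Scope classical_set_scope.
Local Open Scope ring_scope.

Definition dot (R : realType) (n : nat) (a x : 'rV[R]_n) : R :=
  \sum_(i < n) a 0 i * x 0 i.

Definition lspan (R : realType) (V : lmodType R) (S : set V) : set V :=
  [set v | exists (m : nat) (c : 'I_m -> R) (s : 'I_m -> V),
     (forall i, S (s i)) /\ v = \sum_(i < m) c i *: s i].

(* The topology of {uniform T -> R} is that of the (extended) supremum
   distance over T; the ambient space consists of all functions T -> R. *)
Definition uniform_closure (R : realType) (T : choiceType) (S : set (T -> R)) :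
    set (T -> R) :=
  closure (S : set {uniform T -> R}).

(* The library norm on 'rV[R]_k is the max norm, which is equivalent to the
   Euclidean one.  For k = 0 every norm is 0, so the decay condition is void
   and every function on the point belongs to C0. *)
Definition C0 (R : realType) (k : nat) : set ('rV[R]_k -> R) :=
  [set g | continuous g /\
     forall e : R, 0 < e ->
       exists M : R, forall x : 'rV[R]_k, M < `|x| -> `|g x| < e].

(* Only l >= 1 is meaningful; index 0 is a dummy value. *)
Fixpoint neural_space (R : realType) (n : nat) (phi : R -> R) (l : nat) :
    set ('rV[R]_n -> R) :=
  match l with
  | 0%N => set0
  | 1%N => lspan [set h | exists (a : 'rV[R]_n) (b : R),
                  h = (fun x => phi (dot a x + b))]
  | l'.+1 => lspan [set h | exists (f : 'rV[R]_n -> R) (b : R),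
                  neural_space phi l' f /\ h = (fun x => phi (f x + b))]
  end.
Arguments neural_space {R} n phi l _.

Definition neural_space_infty (R : realType) (n : nat) (phi : R -> R) :
    set ('rV[R]_n -> R) :=
  \bigcup_(l in [set l : nat | (1 <= l)%N]) neural_space n phi l.
Arguments neural_space_infty {R} n phi _.

Definition tanh (R : realType) (x : R) : R :=
  (expR x - expR (- x)) / (expR x + expR (- x)).

Definition C0_ridge (R : realType) (n : nat) : set ('rV[R]_n -> R) :=
  [set h | exists (k : nat) (P : {linear 'rV[R]_n -> 'rV[R]_k})
             (g : 'rV[R]_k -> R), C0 g /\ h = (fun x => g (P x))].
Arguments C0_ridge : clear implicits.

Definition tanh_products (R : realType) (n : nat) : set ('rV[R]_n -> R) :=
  [set h | exists (m : nat) (a : 'I_m -> 'rV[R]_n),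
     h = (fun x => \prod_(j < m) tanh (dot (a j) x))].
Arguments tanh_products : clear implicits.

(* Main.v *)
(* A ridge function h (a . x + b) with h vanishing at infinity can be averaged
   over a segment of parameters, uniformly on the whole space, because a large
   argument is bounded for few parameters only.  If phi has equal limits and
   f2 is a second antiderivative of a second difference of phi, extremal at b,
   averaging over dilations gives the integrable function of constant sign
   (f2 (b + x) - f2 b) / x^2; its primitive is a sigmoid, and differences of
   sigmoids generate C0 (R).  Hence the closure of N^1 does not depend on phi,
   and may be studied with phi = 1 / (1 + t^2).  Feynman's parametrization of
   1 / ((u - i) (v - i)) shows that a product of two such ridge functions is an
   average of ridge functions, so that this closure is an algebra; it is
   therefore stable under composition with continuous functions and contains
   C0 (R^k) \o P.

   If the limits differ, phi is a sigmoid, the closure of N^1 contains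
   ln (2 + tanh (a . x)), and products of hyperbolic tangents are obtained by
   composing sums of such functions with exp.  Conversely the addition formula
   of tanh puts every N^l in the algebra generated by the tanh (a . x).
   Finally, for f in N^1, the limit of f (t v) + f (- t v) is the same for all
   but finitely many directions v in a pencil, which fails for
   tanh x_0 * tanh x_1. *)

Require Import Defs.
From HB Require Import structures.
From mathcomp Require Import all_boot all_order all_algebra.
From mathcomp Require Import all_classical all_reals all_analysis.
From mathcomp Require Import ring lra.
Import Order.TTheory GRing.Theory Num.Theory.
Import numFieldNormedType.Exports.
Set Implicit Arguments.
Unset Strict Implicit.
Unset Printing Implicit Defensive.
Local Open Scope classical_set_scope.
Local Open Scope ring_scope.

(** * Uniform limits and linear spans *)

Definition unif_limit (R : realType) (T : Type) (V : set (T -> R)) :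
    set (T -> R) :=
  [set f | forall e : R, 0 < e ->
     exists2 g, V g & forall x, `|f x - g x| <= e].

Definition lin_space (R : realType) (T : Type) (V : set (T -> R)) : Prop :=
  V (fun=> 0) /\
  forall c f g, V f -> V g -> V (fun x => c * f x + g x).

Section UniformLimits.
Context {R : realType}.

Lemma set_ext (T : Type) (V : set (T -> R)) f g : V f -> f =1 g -> V g.
Proof. by move=> Vf /funext <-. Qed.

Lemma uniform_closureE (T : choiceType) (S : set (T -> R)) :
  uniform_closure S = unif_limit S.
Proof.
apply/seteqP; split=> f.
- move=> /= clf e e0.
  have : nbhs (f : {uniform T -> R}) [set g | forall x, `|f x - g x| <= e].
    apply/uniform_nbhs; exists [set p | ball p.1 e p.2]; split.
      by rewrite -entourage_ballE; exists e.
    by move=> h /= fh x; apply/ltW; exact: fh.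
  by move=> /clf [g [Sg /= fg]]; exists g.
- move=> fS B /uniform_nbhs [E [+ EB]].
  rewrite -entourage_ballE => -[e /= e0 eE].
  have e20 : 0 < e / 2 by rewrite divr_gt0.
  have [g Sg fg] := fS _ e20.
  exists g; split => //; apply: EB => x _; apply: eE => /=.
  rewrite /ball /=; apply: le_lt_trans (fg x) _.
  by rewrite ltr_pdivrMr // ltr_pMr // ltr1n.
Qed.

Section Basic.
Context {T : Type}.
Implicit Types V W S : set (T -> R).

Lemma sub_unif_limit V : V `<=` unif_limit V.
Proof. by move=> f Vf e e0; exists f => // x; rewrite subrr normr0 ltW. Qed.

Lemma unif_limit_sub V W : V `<=` unif_limit W ->
  unif_limit V `<=` unif_limit W.
Proof.
move=> VW f Vf e e0; have e20 : 0 < e / 2 by rewrite divr_gt0.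
have [g /VW Wg fg] := Vf _ e20; have [h Wh gh] := Wg _ e20.
exists h => // x; rewrite -(subrKA (g x)) (splitr e).
by apply: le_trans (ler_normD _ _) _; rewrite lerD.
Qed.

Lemma unif_limitK V f : unif_limit (unif_limit V) f -> unif_limit V f.
Proof. exact: unif_limit_sub. Qed.

Lemma unif_limit_eq V W : V `<=` unif_limit W -> W `<=` unif_limit V ->
  unif_limit V = unif_limit W.
Proof. by move=> VW WV; apply/seteqP; split; exact: unif_limit_sub. Qed.

Lemma lin_spaceZ V c f : lin_space V -> V f -> V (fun x => c * f x).
Proof.
move=> [V0 VD] Vf; apply: set_ext (VD c _ _ Vf V0) _ => x.
by rewrite addr0.
Qed.

Lemma lin_spaceD V f g : lin_space V -> V f -> V g -> V (fun x => f x + g x).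
Proof.
move=> [V0 VD] Vf Vg; apply: set_ext (VD 1 _ _ Vf Vg) _ => x.
by rewrite mul1r.
Qed.

Lemma lin_spaceB V f g : lin_space V -> V f -> V g -> V (fun x => f x - g x).
Proof.
move=> lV Vf Vg; apply: set_ext (lV.2 (-1) _ _ Vg Vf) _ => x.
by rewrite mulN1r addrC.
Qed.

Lemma lin_space_sum V (I : Type) (r : seq I) (P : pred I) (F : I -> T -> R) :
  lin_space V -> (forall i, P i -> V (F i)) ->
  V (fun x => \sum_(i <- r | P i) F i x).
Proof.
move=> lV VF; elim: r => [|i r IH].
  by apply: set_ext (lV.1) _ => x; rewrite big_nil.
have [Pi|NPi] := boolP (P i).
  apply: set_ext (lin_spaceD lV (VF _ Pi) IH) _ => x.
  by rewrite big_cons Pi.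
by apply: set_ext IH _ => x; rewrite big_cons (negbTE NPi).
Qed.

Lemma unif_limit_lin V : lin_space V -> lin_space (unif_limit V).
Proof.
move=> lV; split; first by apply: sub_unif_limit; exact: lV.1.
move=> c f g Vf Vg e e0.
pose d := e / (2 * (1 + `|c|)).
have c0 : 0 < 1 + `|c| by rewrite ltr_wpDr.
have d0 : 0 < d by rewrite divr_gt0 // mulr_gt0.
have [f' Vf' ff'] := Vf _ d0; have [g' Vg' gg'] := Vg _ d0.
exists (fun x => c * f' x + g' x); first exact: lV.2.
move=> x.
have -> : c * f x + g x - (c * f' x + g' x) = c * (f x - f' x) + (g x - g' x).
  by ring.
apply: le_trans (ler_normD _ _) _; rewrite normrM.
have h1 : `|c| * `|f x - f' x| <= `|c| * d by rewrite ler_wpM2l.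
have h2 := gg' x.
have -> : e = (1 + `|c|) * d + (1 + `|c|) * d by rewrite /d; field; rewrite gt_eqF.
by move: (normr_ge0 c); nra.
Qed.

Lemma lspan_lin S : lin_space (lspan (S : set (T -> R))).
Proof.
split.
  exists 0%N, (fun=> 0), (fun=> (fun=> 0)); split; first by case.
  by rewrite big_ord0.
move=> a f g [m [c [s [sS ->]]]] [m' [c' [s' [sS' ->]]]].
exists (m + m')%N.
exists (fun i => match fintype.split i with inl j => a * c j | inr j => c' j end).
exists (fun i => match fintype.split i with inl j => s j | inr j => s' j end).
split; first by move=> i; case: fintype.splitP.
rewrite big_split_ord /=; apply/funext => x.
rewrite fctE /=; congr (_ + _).
- rewrite !fct_sumE mulr_sumr; apply: eq_bigr => i _.
  by rewrite (unsplitK (inl i)) /=; rewrite /GRing.scale /= /GRing.scale /= mulrA.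
- rewrite !fct_sumE; apply: eq_bigr => i _.
  by rewrite (unsplitK (inr i)).
Qed.

Lemma sub_lspan S : S `<=` lspan (S : set (T -> R)).
Proof.
move=> f Sf; exists 1%N, (fun=> 1), (fun=> f); split => //.
by rewrite big_ord1 scale1r.
Qed.

Lemma lspan_sub S V : lin_space V -> S `<=` V -> lspan (S : set (T -> R)) `<=` V.
Proof.
move=> lV SV f [m [c [s [sS ->]]]].
apply: (@set_ext _ _ (fun x => \sum_(i < m) c i * s i x)).
  by apply: lin_space_sum => // i _; apply: lin_spaceZ => //; exact: SV.
by move=> x; rewrite fct_sumE.
Qed.

End Basic.
End UniformLimits.

(** * Riemann sums of vanishing functions *)

Definition end_limits (R : realType) (f : R -> R) (l r : R) : Prop :=
  forall e : R, 0 < e -> exists2 A : R, 0 < A &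
    forall x, (A <= x -> `|f x - r| <= e) /\ (x <= - A -> `|f x - l| <= e).

Section UniformContinuity.
Context {R : realType}.

(** The local moduli of continuity are made uniform by the near-covering form of compactness, along
    radii tending to [0] from the right. Only the first point has to lie in [A], which lets both
    later uses compare a point of a compact set with a neighbour outside it. *)
Lemma compact_unif_cont (V : normedModType R) (A : set V) (f : V -> R) :
  compact A -> continuous f -> forall e : R, 0 < e -> exists2 d : R, 0 < d &
    forall x y, A x -> `|x - y| < d -> `|f x - f y| <= e.
Proof.
move=> /compact_near_coveringP cA cf e e0.
have e20 : 0 < e / 2 by rewrite divr_gt0.
have := cA R 0^'+ (fun d x => forall y, `|x - y| < d -> `|f x - f y| <= e) _.
case=> [x Ax|d /= d0 H].
- have /cvgrPdist_lt /(_ _ e20) := cf x.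
  rewrite -nbhs_ballE => -[d /= d0 dP].
  have d20 : 0 < d / 2 by rewrite divr_gt0.
  exists (ball x (d / 2), [set t | t < d / 2]).
    split; first exact: nbhsx_ballx.
    by exists (d / 2) => //= t; rewrite /ball /= sub0r normrN => tx t0;
      apply: le_lt_trans tx; rewrite ler_norm.
  move=> [x' t] /= [+ td] y x'y; rewrite -ball_normE /= => xx'.
  have h1 : `|f x - f x'| < e / 2.
    by apply: dP; rewrite -ball_normE /=; apply: lt_trans xx' _; lra.
  have h2 : `|f x - f y| < e / 2.
    apply: dP; rewrite -ball_normE /= -(subrKA x') (splitr d).
    apply: le_lt_trans (ler_normD _ _) _; rewrite ltrD //.
    exact: lt_trans x'y td.
  rewrite -(subrKA (f x)) (splitr e).
  by apply: le_trans (ler_normD _ _) _; rewrite lerD ?(ltW h2) // distrC ltW.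
- exists (d / 2); first by rewrite divr_gt0.
  move=> x y Ax xy; apply: (H (d / 2)) => //=.
  - rewrite sub0r normrN gtr0_norm ?divr_gt0 //.
    by rewrite ltr_pdivrMr // ltr_pMr // ltr1n.
  - by rewrite divr_gt0.
Qed.

(** Compactness settles the case of [x] in [[- (A + 1), A + 1]]. For other [x] the margin [1],
    together with [|x - y| <= 1], keeps both points beyond [A] at the same end, where [f] is within
    [e / 2] of its limit. *)
Lemma end_limits_unif_cont (f : R -> R) l r :
  continuous f -> end_limits f l r -> forall e : R, 0 < e -> exists2 d : R, 0 < d &
    forall x y, `|x - y| <= d -> `|f x - f y| <= e.
Proof.
move=> cf lf e e0; have e20 : 0 < e / 2 by rewrite divr_gt0.
have [A A0 HA] := lf _ e20.
have [d d0 Hd] := 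
  @compact_unif_cont R^o _ f (@segment_compact R (- (A + 1)) (A + 1)) cf _ e0.
exists (Num.min 1 (d / 2)); first by rewrite lt_min ltr01 divr_gt0.
move=> x y; rewrite le_min => /andP[xy1 xyd].
have xyd' : `|x - y| < d.
  by apply: le_lt_trans xyd _; rewrite ltr_pdivrMr // ltr_pMr // ltr1n.
have [xA|/negP xA] := boolP (x \in `[- (A + 1), A + 1]); first exact: Hd.
move: xA; rewrite in_itv /= => /negP; rewrite negb_and -!ltNge.
move: xy1; rewrite ler_norml => /andP[xy1 xy2].
have H (z : R) : `|f x - z| <= e / 2 -> `|f y - z| <= e / 2 -> `|f x - f y| <= e.
  move=> h1; rewrite distrC => h2; rewrite -(subrKA z) (splitr e).
  by apply: le_trans (ler_normD _ _) _; rewrite lerD.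
move=> /orP[xA|xA].
  by apply: (H l); [apply: (HA x).2|apply: (HA y).2]; lra.
by apply: (H r); [apply: (HA x).1|apply: (HA y).1]; lra.
Qed.

Lemma end_limits_bounded (f : R -> R) l r :
  continuous f -> end_limits f l r ->
  exists2 C : R, 0 < C & forall x, `|f x| <= C.
Proof.
move=> cf lf; have [A A0 HA] := lf _ ltr01.
have AA : - A <= A by lra.
have cnf : {within `[- A, A], continuous (fun x => `|f x|)}.
  apply: continuous_subspaceT => x.
  by apply: continuous_comp; [exact: cf|exact: norm_continuous].
have [c _ Hc] := EVT_max AA cnf.
exists (`|f c| + `|l| + `|r| + 1); first by rewrite ltr_wpDl // !addr_ge0.
move=> x; have [xA|/negP] := boolP (x \in `[- A, A]).
  apply: le_trans (Hc _ xA) _.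
  by rewrite -!addrA lerDl !addr_ge0.
rewrite in_itv /= => /negP; rewrite negb_and -!ltNge => /orP[|] xA.
  have : `|f x - l| <= 1 by apply: (HA x).2; lra.
  move: (lerB_dist (f x) l) (normr_ge0 (f c)) (normr_ge0 r); lra.
have : `|f x - r| <= 1 by apply: (HA x).1; lra.
move: (lerB_dist (f x) r) (normr_ge0 (f c)) (normr_ge0 l); lra.
Qed.

End UniformContinuity.

Section RiemannSums.
Context {R : realType}.

Lemma sum_le_nat_count (K : R) n : 0 <= K ->
  \sum_(j < n) (j%:R <= K)%R%:R <= K + 1 :> R.
Proof.
move=> K0; elim: n => [|n IH]; first by rewrite big_ord0 addr_ge0.
rewrite big_ord_recr /=; have [nK|_] := boolP (n%:R <= K); last by rewrite addr0.
rewrite lerD2r; apply: le_trans nK.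
have -> : n%:R = \sum_(j < n) (1 : R) by rewrite sumr_const card_ord.
by apply: ler_sum => j _; rewrite lern1 leq_b1.
Qed.

(** Two indices whose terms lie in [[- M, M]] differ by at most [2 * M / |d|]. Counting backwards
    from the last such index reduces the claim to counting natural numbers below a bound. *)
Lemma progression_count (c d M : R) n : d != 0 -> 0 <= M ->
  \sum_(i < n) (`|c + i%:R * d| <= M)%R%:R <= 2 * M / `|d| + 1 :> R.
Proof.
move=> d0 M0; have nd0 : 0 < `|d| by rewrite normr_gt0.
have K0 : 0 <= 2 * M / `|d| by rewrite divr_ge0 // mulr_ge0.
elim: n => [|n IH]; first by rewrite big_ord0 addr_ge0.
have [nM|nM] := boolP (`|c + n%:R * d| <= M); last first.
  by rewrite big_ord_recr /= (negbTE nM) addr0.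
apply: le_trans (sum_le_nat_count n.+1 K0).
rewrite [leRHS](reindex_inj rev_ord_inj) /=; apply: ler_sum => i _.
have [iM|_] := boolP (`|c + i%:R * d| <= M); last by rewrite ler0n.
suff -> : (n.+1 - i.+1)%N%:R <= 2 * M / `|d| by [].
rewrite ler_pdivlMr // subSS natrB; last by rewrite -ltnS.
have ni : (i%:R : R) <= n%:R by rewrite ler_nat -ltnS.
rewrite -[X in X * _]ger0_norm ?subr_ge0 // -normrM.
have -> : (n%:R - i%:R) * d = (c + n%:R * d) - (c + i%:R * d) by ring.
by apply: le_trans (ler_normB _ _) _; lra.
Qed.

Lemma truncn_bound (x : R) : x < (Num.truncn `|x|).+1%:R.
Proof.
apply: le_lt_trans (ler_norm x) _.
by have /andP[] := truncn_itv (normr_ge0 x).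
Qed.

(* If [`|d|] is small the integrand is uniformly continuous in [u]; if it is
   large, [c + u * d] is bounded for a small proportion of the [u]'s only.
   Hence a number of nodes that does not depend on [c] and [d]. *)
Lemma riemann_sum (h w : R -> R) : continuous h -> end_limits h 0 0 ->
  (forall u : R, 0 <= u <= 1 -> `|w u| <= 1) ->
  (forall u v : R, `|w u - w v| <= `|u - v|) ->
  forall e : R, 0 < e -> exists N : nat, forall (c d : R) (G : R -> R),
    (forall u : R, 0 <= u <= 1 -> is_derive u 1 G (w u * h (c + u * d))) ->
    `|G 1 - G 0 -
      \sum_(i < N) N%:R^-1 * (w (i%:R / N%:R) * h (c + i%:R / N%:R * d))| <= e.
Proof.
move=> ch lh w1 wL e e0.
have [C C0 hC] := end_limits_bounded ch lh.
have e4 : 0 < e / 4 by rewrite divr_gt0.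
have e8 : 0 < e / 8 by rewrite divr_gt0.
have [dl dl0 hdl] := end_limits_unif_cont ch lh e4.
have [M M0 hM] := lh _ e8.
(* Beyond the threshold [L] the parameters [u] with [|c + u * d| <= M] fill a proportion of at most
   [2 * M / L = e / (8 * C)]. In [X], the summand [24 * C / e] absorbs the errors of order [C / N],
   and [L / dl] gives [|d| / N <= dl] as long as [|d| <= L]. *)
pose L := 16 * C * M / e.
have L0 : 0 < L by rewrite divr_gt0 // !mulr_gt0.
pose X := 24 * C / e + L / dl + 1.
pose N := (Num.truncn `|X|).+1.
have XN : X < N%:R := truncn_bound X.
have N0 : 0 < N%:R :> R by rewrite ltr0n.
have Nn0 : N%:R != 0 :> R by rewrite gt_eqF.
have CeN : 24 * C <= e * N%:R.
  have : 24 * C / e <= N%:R.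
    have : 0 < L / dl by rewrite divr_gt0.
    by rewrite /X in XN; lra.
  by rewrite ler_pdivrMr // [e * _]mulrC.
have LN : L <= dl * N%:R.
  have : L / dl <= N%:R.
    have : 0 < 24 * C / e by rewrite divr_gt0 // mulr_gt0.
    by rewrite /X in XN; lra.
  by rewrite ler_pdivrMr // [dl * _]mulrC.
exists N => c d G dG.
pose x i : R := i%:R / N%:R.
have x01 i : (i <= N)%N -> 0 <= x i <= 1.
  by move=> iN; rewrite divr_ge0 //= ler_pdivrMr // mul1r ler_nat.
have xS i : x i.+1 - x i = N%:R^-1.
  by rewrite /x -mulrBl -natrB // subSnn mul1r.
have -> : G 1 - G 0 = \sum_(i < N) (G (x i.+1) - G (x i)).
  rewrite -(big_mkord xpredT (fun i => G (x i.+1) - G (x i))).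
  by rewrite (telescope_sumr (fun i => G (x i))) // /x divff // mulr0n mul0r.
rewrite -sumrB; apply: le_trans (ler_norm_sum _ _ _) _.
(* The mean value theorem turns each increment of [G] into the integrand at some point of the cell,
   so the integral enters only through its primitive. *)
have step (i : 'I_N) : exists2 z, x i <= z <= x i.+1 &
    G (x i.+1) - G (x i) = N%:R^-1 * (w z * h (c + z * d)).
  have i1 := x01 i (ltnW (ltn_ord i)); have i2 := x01 i.+1 (ltn_ord i).
  have xx : x i <= x i.+1 by rewrite -subr_ge0 xS invr_ge0 ler0n.
  have inI z : x i <= z <= x i.+1 -> 0 <= z <= 1.
    move: i1 i2 => /andP[? ?] /andP[? ?] /andP[? ?].
    by apply/andP; split; lra.
  have cG : {within `[x i, x i.+1], continuous G}.
    apply: derivable_within_continuous => z; rewrite in_itv /= => zi.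
    by have [] := dG z (inI _ zi).
  have dG' z : z \in `]x i, x i.+1[ -> is_derive z 1 G (w z * h (c + z * d)).
    rewrite in_itv /= => /andP[z1 z2]; apply: dG; apply: inI.
    by rewrite !ltW.
  have [z zi ->] := MVT_segment xx dG' cG.
  by exists z; [move: zi; rewrite in_itv|rewrite xS mulrC].
have [dL|Ld] := lerP `|d| L.
- have -> : e = \sum_(i < N) (N%:R^-1 * e).
    by rewrite sumr_const card_ord -[RHS]mulr_natl mulrA divff // mul1r.
  apply: ler_sum => i _; have [z /andP[z1 z2] ->] := step i.
  rewrite -mulrBr normrM ger0_norm ?invr_ge0 ?ler0n // ler_wpM2l ?invr_ge0 //.
  have zx : `|z - x i| <= N%:R^-1.
    by have := xS i; rewrite ger0_norm; lra.
  have z01 : 0 <= z <= 1.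
    move: (x01 i (ltnW (ltn_ord i))) (x01 i.+1 (ltn_ord i)) => /andP[? ?] /andP[? ?].
    by apply/andP; split; lra.
  have -> : w z * h (c + z * d) - w (x i) * h (c + x i * d) =
    w z * (h (c + z * d) - h (c + x i * d)) + (w z - w (x i)) * h (c + x i * d).
    by ring.
  apply: le_trans (ler_normD _ _) _; rewrite !normrM.
  have t1 : `|w z| * `|h (c + z * d) - h (c + x i * d)| <= 1 * (e / 4).
    apply: ler_pM => //; first exact: w1.
    apply: hdl; rewrite opprD addrACA subrr add0r -mulrBl normrM.
    apply: le_trans (ler_pM _ _ zx dL) _ => //.
    by rewrite mulrC ler_pdivrMr.
  have t2 : `|w z - w (x i)| * `|h (c + x i * d)| <= N%:R^-1 * C.
    by apply: ler_pM => //; exact: le_trans zx.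
  have t3 : N%:R^-1 * C <= e / 24.
    by rewrite mulrC ler_pdivrMr //; lra.
  lra.
- have d0 : d != 0 by rewrite -normr_gt0 (lt_trans L0).
  have nd0 : 0 < `|d| by rewrite normr_gt0.
  (* Widening [M] by one mesh step ensures that a node outside [M'] has its whole cell mapped beyond
     [M], where [h] is small. *)
  pose M' := M + `|d| / N%:R.
  have M'0 : 0 <= M' by rewrite addr_ge0 ?divr_ge0 // ltW.
  pose b i : R := (`|c + i%:R * (d / N%:R)| <= M')%R%:R.
  have -> : e = e / 4 + e * (3 / 4) by field.
  apply: (@le_trans _ _ (\sum_(i < N) N%:R^-1 * (e / 4 + 2 * C * b i))).
    apply: ler_sum => i _; have [z /andP[z1 z2] ->] := step i.
    have zx : `|z - x i| <= N%:R^-1.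
      by have := xS i; rewrite ger0_norm; lra.
    have z01 : 0 <= z <= 1.
      move: (x01 i (ltnW (ltn_ord i))) (x01 i.+1 (ltn_ord i)) => /andP[? ?] /andP[? ?].
      by apply/andP; split; lra.
    rewrite -mulrBr normrM ger0_norm ?invr_ge0 ?ler0n // ler_wpM2l ?invr_ge0 //.
    have big y : 0 <= y <= 1 -> `|w y * h (c + y * d)| <= `|h (c + y * d)|.
      by move=> y01; rewrite normrM -[leRHS]mul1r ler_wpM2r // w1.
    have H : `|w z * h (c + z * d) - w (x i) * h (c + x i * d)| <=
        `|h (c + z * d)| + `|h (c + x i * d)|.
      apply: le_trans (ler_normB _ _) _; rewrite lerD // big //.
      exact: x01 (ltnW (ltn_ord i)).
    apply: le_trans H _.
    have bE : c + i%:R * (d / N%:R) = c + x i * d by rewrite /x; field.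
    rewrite /b bE.
    have [_|] := boolP (`|c + x i * d| <= M').
      rewrite mulr1n mulr1; move: (hC (c + z * d)) (hC (c + x i * d)); lra.
    rewrite -ltNge mulr0n mulr0 addr0 => cM.
    have far y : M <= `|y| -> `|h y| <= e / 8.
      rewrite ler_normr => /orP[|] yM.
        by have := (hM y).1 yM; rewrite subr0.
      have /(hM y).2 : y <= - M by lra.
      by rewrite subr0.
    have f1 : `|h (c + x i * d)| <= e / 8.
      apply: far; apply: le_trans (ltW cM).
      by rewrite /M' lerDl divr_ge0 // ltW.
    have f2 : `|h (c + z * d)| <= e / 8.
      apply: far.
      have e1 : `|(x i - z) * d| <= `|d| / N%:R.
        by rewrite normrM distrC mulrC ler_wpM2l.
      have := lerB_dist (c + x i * d) ((x i - z) * d).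
      have -> : c + x i * d - (x i - z) * d = c + z * d by ring.
      move: e1 cM; rewrite /M'; lra.
    lra.
  rewrite -mulr_sumr big_split /= sumr_const card_ord -mulr_sumr.
  have Nd0 : d / N%:R != 0 by rewrite mulf_neq0 // invr_neq0.
  have cnt := progression_count c N Nd0 M'0.
  rewrite mulrDr -[(e / 4) *+ N]mulr_natl mulKf // lerD2l.
  rewrite mulrC ler_pdivrMr //.
  apply: le_trans (_ : 2 * C * (2 * M' / `|d / N%:R| + 1) <= _).
    by rewrite ler_wpM2l // mulr_ge0 // ltW.
  have -> : 2 * M' / `|d / N%:R| = 2 * M * N%:R / `|d| + 2.
    rewrite /M' normrM normfV (ger0_norm (ler0n _ N)); field.
    by rewrite Nn0 gt_eqF.
  have : C * M * N%:R / `|d| <= e / 16 * N%:R.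
    rewrite ler_pdivrMr // [leRHS]mulrAC ler_wpM2r //.
    have : L * e <= `|d| * e by rewrite ler_wpM2r // ltW.
    have -> : L * e = 16 * C * M by rewrite /L; field; rewrite gt_eqF.
    lra.
  have -> : 2 * C * (2 * M * N%:R / `|d| + 2 + 1) =
    4 * (C * M * N%:R / `|d|) + 6 * C by field; rewrite gt_eqF.
  lra.
Qed.

End RiemannSums.

(** * Superpositions of sigmoids *)

Section SigmoidApproximation.
Context {R : realType}.

(** Here [k] is the number of nodes among the first [m] that do not exceed [x]; the jumps at these
    nodes telescope and the others contribute nothing. *)
Lemma step_sum (t F : nat -> R) (x : R) m : (forall i, t i <= t i.+1) ->
  exists k, [/\ (k <= m)%N, ((0 < k)%N -> t k.-1 <= x),
    ((k < m)%N -> x < t k) &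
    \sum_(i < m) (F i.+1 - F i) * (t i <= x)%R%:R = F k - F 0%N].
Proof.
move=> tS; elim: m => [|m [k [km k1 k2 sE]]].
  by exists 0%N; split => //; rewrite big_ord0 subrr.
rewrite big_ord_recr /= sE.
have [tx|xt] := lerP (t m) x.
  have {}km : k = m.
    apply/eqP; rewrite eqn_leq km leqNgt; apply/negP => /[dup] lkm /k2 xk.
    have : t k <= t m by apply: (Order.NatMonotonyTheory.nondecnP tS); exact: ltnW.
    by move=> /(lt_le_trans xk); rewrite ltNge tx.
  by exists m.+1; split => //; [rewrite ltnn|rewrite km mulr1; ring].
exists k; split => //; first exact: leqW.
  rewrite ltnS leq_eqVlt => /orP[/eqP -> //|]; exact: k2.
by rewrite mulr0 addr0.
Qed.

(* [f] is approximated by a step function with small jumps at the [t i], and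
   each jump is replaced by a steep copy of [s]; only boundedly many of these
   copies are far from a step at a given point. *)
Lemma sigmoid_approx (s f : R -> R) l r : continuous s -> end_limits s 0 1 ->
  continuous f -> end_limits f l r -> forall e : R, 0 < e ->
  exists m (a : R) (t d : nat -> R), \sum_(i < m) d i = r - l /\
    forall x, `|f x - (l + \sum_(i < m) d i * s (a * (x - t i)))| <= e.
Proof.
move=> cs ls cf lf e e0.
have [C C0 sC] := end_limits_bounded cs ls.
(* The step function is within [2 * e1] of [f], and replacing its jumps by copies of [s] costs at
   most [3 * e1 * (2 * C + 3)]; the total is [(6 * C + 11) * e1]. *)
pose e1 := e / (6 * C + 11).
have K0 : 0 < 6 * C + 11 by lra.
have e10 : 0 < e1 by rewrite divr_gt0.
have [dl dl0 hdl] := end_limits_unif_cont cf lf e10.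
have [A A0 hA] := lf _ e10.
pose m := (Num.truncn `|2 * A / dl|).+1.
have Am : 2 * A <= m%:R * dl.
  by rewrite -ler_pdivrMr // ltW // truncn_bound.
have m0 : 0 < m%:R :> R by rewrite ltr0n.
pose t i : R := i%:R * dl - A.
have tS i : t i.+1 = t i + dl by rewrite /t -addn1 natrD; ring.
have tm : A <= t m by rewrite /t; lra.
have t0 : t 0%N = - A by rewrite /t mulr0n; ring.
(* Using the limits as the two end values makes the jumps sum to exactly [r - l], at the cost of one
   more [e1]. *)
pose F i := if i == 0%N then l else if i == m then r else f (t i).
have F0 : F 0%N = l by [].
have Fm : F m = r by rewrite /F eqxx.
have Ft i : `|F i - f (t i)| <= e1.
  rewrite /F; case: eqP => [->|_].
    by rewrite distrC; apply: (hA _).2; rewrite t0.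
  case: eqP => [->|_]; last by rewrite subrr normr0 ltW.
  by rewrite distrC; exact: (hA _).1.
have near x y : `|x - y| <= dl -> `|f x - f y| <= e1 by exact: hdl.
pose d i := F i.+1 - F i.
have dB i : `|d i| <= 3 * e1.
  have h : `|f (t i.+1) - f (t i)| <= e1.
    by apply: near; rewrite tS addrAC subrr add0r gtr0_norm.
  move: (Ft i) (Ft i.+1) h; rewrite /d !ler_norml => /andP[? ?] /andP[? ?] /andP[? ?].
  by apply/andP; split; lra.
have im0 : 0 < m%:R^-1 :> R by rewrite invr_gt0.
have [B B0 hB] := ls _ im0.
(* With this slope, [s] is within [1 / m] of the step at distance [dl / 2] or more from its node, so
   that all [m] far nodes together cost no more than one jump. At most two nodes are closer to a
   given point. *)
pose a := 2 * B / dl.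
have a0 : 0 < a by rewrite divr_gt0 // mulr_gt0.
exists m, a, t, d; split.
  rewrite -(big_mkord xpredT d) /d telescope_sumr //.
  by rewrite Fm F0.
move=> x.
have tS' i : t i <= t i.+1 by rewrite tS lerDl ltW.
have [k [km k1 k2 sE]] := step_sum F x m tS'.
have fF : `|f x - F k| <= 2 * e1.
  have [k0|k0] := posnP k.
    rewrite k0 in k2 *; have := k2 isT; rewrite t0 F0 => xA.
    by have := (hA x).2 (ltW xA); lra.
  move: (k1 k0) => {}k1.
  have tk : t k = t k.-1 + dl by rewrite -tS prednK.
  have nr : x <= t k -> `|f x - f (t k)| <= e1.
    by move=> xt; apply: near; rewrite ler_norml; apply/andP; split; lra.
  move: km; rewrite leq_eqVlt => /orP[/eqP kE|km].
    have Fk : F k = r by rewrite kE.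
    have [Ax|xA] := lerP A x.
      by have := (hA x).1 Ax; rewrite Fk; lra.
    have xt : x <= t k by rewrite kE ltW // (lt_le_trans xA).
    move: (Ft k) (nr xt); rewrite !ler_norml => /andP[? ?] /andP[? ?].
    by apply/andP; split; lra.
  have := nr (ltW (k2 km)); rewrite /F (gtn_eqF k0) (ltn_eqF km); lra.
pose b i : R := (`|(x + A) + i%:R * (- dl)| <= dl / 2)%R%:R.
have bE : \sum_(i < m) b i <= 2.
  have dln0 : - dl != 0 by rewrite oppr_eq0 gt_eqF.
  have dl20 : 0 <= dl / 2 by rewrite divr_ge0 // ltW.
  have := progression_count (x + A) m dln0 dl20.
  rewrite normrN gtr0_norm //.
  by have -> : 2 * (dl / 2) / dl + 1 = 2 by field; rewrite gt_eqF.
have sH i : `|s (a * (x - t i)) - (t i <= x)%R%:R| <= m%:R^-1 + (C + 1) * b i.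
  rewrite /b; have -> : x + A + i%:R * - dl = x - t i by rewrite /t; ring.
  have [h|] := boolP (`|x - t i| <= dl / 2).
    apply: le_trans (ler_normB _ _) _; rewrite mulr1n mulr1.
    have h2 : `|(t i <= x)%R%:R| <= 1 :> R.
      by case: (t i <= x); rewrite ?mulr0n ?normr1 ?normr0.
    move: (sC (a * (x - t i))) h2 im0.
    move: `|s _| `|_%:R| (_^-1) => u v w; lra.
  rewrite -ltNge mulr0n mulr0 addr0 ltr_normr => h.
  have ad : a * (dl / 2) = B by rewrite /a; field; rewrite gt_eqF.
  case: (lerP (t i) x) => tx.
    rewrite mulr1n; apply: (hB _).1; rewrite -ad ler_wpM2l //; first exact: ltW.
    by move: h => /orP[|]; lra.
  rewrite mulr0n; apply: (hB _).2.
  rewrite -ad -mulrN ler_wpM2l //; first exact: ltW.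
  by move: h => /orP[|]; lra.
have dif : `|\sum_(i < m) d i * s (a * (x - t i)) - (F k - F 0%N)|
    <= 3 * e1 * (2 * C + 3).
  rewrite -sE -sumrB; apply: le_trans (ler_norm_sum _ _ _) _.
  apply: (@le_trans _ _ (\sum_(i < m) 3 * e1 * (m%:R^-1 + (C + 1) * b i))).
    by apply: ler_sum => i _; rewrite -mulrBr normrM ler_pM.
  have e13 : 0 <= 3 * e1 by rewrite mulr_ge0 // ltW.
  rewrite -mulr_sumr; apply: ler_wpM2l => //.
  rewrite big_split /= sumr_const card_ord -mulr_sumr.
  rewrite -[_^-1 *+ m]mulr_natl divff ?gt_eqF //.
  have : (C + 1) * \sum_(i < m) b i <= (C + 1) * 2 by rewrite ler_wpM2l //; lra.
  lra.
have eE : e = e1 * (6 * C + 11) by rewrite /e1; field; rewrite gt_eqF.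
rewrite eE; move: fF dif; rewrite F0 !ler_norml => /andP[? ?] /andP[? ?].
by apply/andP; split; lra.
Qed.

End SigmoidApproximation.

(** * Antiderivatives and derivatives in one variable *)

Section Antiderivatives.
Context {R : realType}.
Notation mu := (@lebesgue_measure R).

(** The fundamental theorem of calculus applies to integrals with a fixed lower endpoint [a < x].
    The function [F] is the integral from [0] with its sign, and near each [x] it agrees up to a
    constant with the integral from a point [a] lying below both [x] and [0]. *)
Lemma ex_antiderivative (f : R -> R) : continuous f ->
  exists F : R -> R, forall x : R, is_derive x 1 F (f x).
Proof.
move=> cf.
have fi a b : mu.-integrable `[a, b] (EFin \o f).
  apply: continuous_compact_integrable; first exact: segment_compact.
  exact: continuous_subspaceT.
pose I a x : R := (\int[mu]_(t in [set` `[a, x]]) (f t))%R.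
have dI (a x : R) : a < x -> is_derive x 1 (I a) (f x).
  move=> ax; have [] := @continuous_FTC1_closed R f a x (x + 1) _ (fi _ _) ax (cf x).
    by rewrite ltrDl.
  by move=> d1 d2; rewrite -d2 derive1E; exact: derivableP.
have IB (a b x : R) : a <= b -> b <= x -> I a x - I a b = I b x.
  move=> ab bx; rewrite /I Rintegral_itvB ?bnd_simp //.
  apply: Rintegral_itv_obnd_cbnd.
  by apply: integrableS (fi b x) => //; apply: subset_itvr; rewrite bnd_simp.
pose F x := if 0 <= x then I 0 x else - I x 0.
have FE (a x : R) : a <= 0 -> a <= x -> F x = I a x - I a 0.
  move=> a0 ax; rewrite /F; case: lerP => x0.
    by rewrite IB.
  by rewrite -(IB a x 0) // ?opprB // ltW.
exists F => x.
pose a := Num.min x 0 - 1.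
have ax : a < x.
  have : Num.min x 0 <= x by rewrite ge_min lexx.
  by rewrite /a; lra.
have a0 : a <= 0.
  have : Num.min x 0 <= 0 by rewrite ge_min lexx orbT.
  by rewrite /a; lra.
apply: (@near_eq_is_derive _ _ _ (fun y => I a y - I a 0)).
- near=> y; rewrite (FE a) // ltW //.
  by near: y; exact: lt_nbhsr.
- rewrite -[f x]subr0; apply: is_deriveB; exact: dI.
Unshelve. all: by end_near. Qed.

End Antiderivatives.

Section Derivatives.
Context {R : realType}.
Implicit Types (f g : R -> R) (x a b k : R).

Lemma derive1_cst k x : is_derive x 1 (fun=> k) 0.
Proof. exact: is_derive_cst. Qed.

Lemma derive1_id x : is_derive x 1 (fun y => y) 1.
Proof. exact: is_derive_id. Qed.

Lemma derive1D f g x a b : is_derive x 1 f a -> is_derive x 1 g b ->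
  is_derive x 1 (fun y => f y + g y) (a + b).
Proof. exact: is_deriveD. Qed.

Lemma derive1B f g x a b : is_derive x 1 f a -> is_derive x 1 g b ->
  is_derive x 1 (fun y => f y - g y) (a - b).
Proof. exact: is_deriveB. Qed.

Lemma derive1M f g x a b : is_derive x 1 f a -> is_derive x 1 g b ->
  is_derive x 1 (fun y => f y * g y) (a * g x + f x * b).
Proof.
move=> df dg; apply: is_derive_eq (is_deriveM df dg) _.
by rewrite /GRing.scale /= addrC mulrC.
Qed.

Lemma derive1Z f k x a : is_derive x 1 f a ->
  is_derive x 1 (fun y => k * f y) (k * a).
Proof. exact: is_deriveZ. Qed.

Lemma derive1V f x a : f x != 0 -> is_derive x 1 f a ->
  is_derive x 1 (fun y => (f y)^-1) (- a / f x ^+ 2).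
Proof.
move=> fx0 df; apply: is_derive_eq (is_deriveV fx0 df) _.
by rewrite /GRing.scale /= !mulNr mulrC.
Qed.

Lemma derive1_affine f a b x k : is_derive (b + x * a) 1 f k ->
  is_derive x 1 (fun y => f (b + y * a)) (k * a).
Proof.
move=> df; apply: (@is_derive1_comp _ f (fun y => b + y * a)) => //.
apply: is_derive_eq (derive1D (is_derive_cst b x 1)
  (derive1M (is_derive_id x 1) (is_derive_cst a x 1))) _.
by rewrite mulr0 addr0 add0r mul1r.
Qed.

Lemma derive1_unique f x a b : is_derive x 1 f a -> is_derive x 1 f b -> a = b.
Proof. by move=> [_ <-] [_ <-]. Qed.

Lemma MVT1 f df x y : x < y -> (forall z : R, x <= z <= y -> is_derive z 1 f (df z)) ->
  exists2 z : R, x <= z <= y & f y - f x = df z * (y - x).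
Proof.
move=> xy dfE.
have dfE' z : z \in `]x, y[ -> is_derive z 1 f (df z).
  by rewrite in_itv /= => /andP[? ?]; apply: dfE; rewrite !ltW.
have cf : {within `[x, y], continuous f}.
  apply: derivable_within_continuous => z; rewrite in_itv /= => zi.
  by have [] := dfE z zi.
have [z zi ->] := MVT xy dfE' cf.
by exists z => //; move: zi; rewrite in_itv /= => /andP[? ?]; rewrite !ltW.
Qed.

Lemma nondecreasing_end_limits f B : {homo f : x y / x <= y} ->
  (forall x, `|f x| <= B) ->
  exists l r, end_limits f l r /\ forall x, l <= f x <= r.
Proof.
move=> fm fB.
have sf : has_sup (range f).
  split; first by exists (f 0), 0.
  by exists B => _ [x _ <-]; apply: le_trans (fB x); exact: ler_norm.
have si : has_inf (range f).
  split; first by exists (f 0), 0.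
  exists (- B) => _ [x _ <-]; have := fB x; rewrite ler_norml; by case/andP.
have fr x : f x <= sup (range f) by apply: sup_upper_bound => //; exists x.
have fl x : inf (range f) <= f x by apply: ge_inf; [case: si|exists x].
exists (inf (range f)), (sup (range f)); split; last by move=> x; rewrite fr fl.
move=> e e0.
have [_ [y _ <-] ye] := sup_adherent e0 sf.
have [_ [z _ <-] ze] := inf_adherent e0 si.
exists (`|y| + `|z| + 1); first by rewrite ltr_wpDl // addr_ge0.
move=> x; split=> xA.
  have /fm : y <= x by apply: le_trans xA; move: (ler_norm y) (normr_ge0 z); lra.
  by move: (fr x); rewrite ler_norml => ? ?; apply/andP; split; lra.
have /fm : x <= z.
  apply: le_trans xA _; move: (normr_ge0 y) (ler_norm (- z)); rewrite normrN; lra.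
by move: (fl x); rewrite ler_norml => ? ?; apply/andP; split; lra.
Qed.

Lemma end_limits_max_attained f x0 : continuous f -> end_limits f 0 0 ->
  0 < f x0 -> exists2 b : R, 0 < f b & forall x, f x <= f b.
Proof.
move=> cf lf f0; have [A A0 hA] := lf _ f0.
pose B := A + `|x0|.
have AB : - B <= B by rewrite /B; move: (normr_ge0 x0); lra.
have cf' : {within `[- B, B], continuous f} by exact: continuous_subspaceT.
have [b _ hb] := EVT_max AB cf'.
have x0b : f x0 <= f b.
  apply: hb; rewrite in_itv /= /B; move: (ler_norm x0) (ler_norm (- x0)).
  by rewrite normrN => ? ?; apply/andP; split; lra.
exists b; first exact: lt_le_trans x0b.
move=> x; have [xB|/negP] := boolP (x \in `[- B, B]); first exact: hb.
rewrite in_itv /= => /negP; rewrite negb_and -!ltNge => xB.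
apply: le_trans x0b; apply: le_trans (ler_norm _) _.
move: xB (normr_ge0 x0) => /orP[] xB n0.
  by have := (hA x).2; rewrite subr0; apply; rewrite /B in xB; lra.
by have := (hA x).1; rewrite subr0; apply; rewrite /B in xB; lra.
Qed.

End Derivatives.

(** * Spans of translates and dilates of a function of one variable *)

Definition dilates (R : realType) (phi : R -> R) : set (R -> R) :=
  lspan [set h | exists a b : R, h = fun t => phi (a * t + b)].

Section Dilates.
Context {R : realType}.

(** Substituting [u x] for the variable is linear and does not increase uniform distances, so it is
    enough to treat the generators. This carries one-variable approximation over to ridge functions
    and to deeper layers. *)
Lemma dilates_comp (T : Type) (V : set (T -> R)) (phi : R -> R) (u : T -> R) :
  lin_space V -> (forall a b, unif_limit V (fun x => phi (a * u x + b))) ->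
  forall h, unif_limit (dilates phi) h -> unif_limit V (fun x => h (u x)).
Proof.
move=> lV Vphi h hl; apply: unif_limitK => e e0; have [g gD hg] := hl _ e0.
exists (fun x => g (u x)); last by move=> x; exact: hg.
pose W := [set k : R -> R | unif_limit V (fun x => k (u x))].
have lV' := unif_limit_lin lV.
have lW : lin_space W.
  split; first exact: lV'.1.
  by move=> c f k Wf Wk; apply: (lV'.2 c _ _ Wf Wk).
apply: (lspan_sub lW _ gD) => _ [a [b ->]]; exact: Vphi.
Qed.

Lemma unif_limit_continuous (V : set (R -> R)) f :
  (forall g, V g -> continuous g) -> unif_limit V f -> continuous f.
Proof.
move=> Vc Vf x; apply/cvgrPdist_le => e e0.
have e3 : 0 < e / 3 by rewrite divr_gt0.
have [g /Vc cg fg] := Vf _ e3.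
have /cvgrPdist_le /(_ _ e3) := cg x; apply: filterS => y gxy.
move: (fg x) (fg y) gxy; rewrite !ler_norml => /andP[? ?] /andP[? ?] /andP[? ?].
by apply/andP; split; lra.
Qed.

Lemma continuous_lincomb (T : topologicalType) (c : R) (f g : T -> R) :
  continuous f -> continuous g -> continuous (fun t => c * f t + g t).
Proof.
move=> cf cg x; apply: cvgD; last exact: cg.
by apply: cvgM; [exact: cvg_cst|exact: cf].
Qed.

Lemma continuous_affine (a b : R) : continuous (fun t : R => a * t + b).
Proof.
move=> x; apply: cvgD; last exact: cvg_cst.
by apply: cvgM; [exact: cvg_cst|exact: cvg_id].
Qed.

Lemma dilates_continuous (phi : R -> R) f : continuous phi ->
  unif_limit (dilates phi) f -> continuous f.
Proof.
move=> cphi; apply: unif_limit_continuous => g.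
apply: (@lspan_sub _ _ _ [set g | continuous g]).
  split; first by move=> x; exact: cst_continuous.
  by move=> c f' g' cf cg; exact: continuous_lincomb.
move=> _ [a [b ->]] x.
exact: (continuous_comp (@continuous_affine a b x) (cphi _)).
Qed.

(** The function [F] is the average of [w u * h (c x + u * d x)] over [u] in [[0, 1]], expressed
    through a primitive that may depend on [x]. The number of nodes in [riemann_sum] is independent
    of [x], hence the Riemann sums converge uniformly. *)
Lemma riemann_unif_limit (T : Type) (V : set (T -> R)) (h w : R -> R)
    (c d F : T -> R) :
  lin_space V -> continuous h -> end_limits h 0 0 ->
  (forall u : R, 0 <= u <= 1 -> `|w u| <= 1) ->
  (forall u v : R, `|w u - w v| <= `|u - v|) ->
  (forall u, unif_limit V (fun x => h (c x + u * d x))) ->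
  (forall x, exists G : R -> R, F x = G 1 - G 0 /\
    forall u : R, 0 <= u <= 1 -> is_derive u 1 G (w u * h (c x + u * d x))) ->
  unif_limit V F.
Proof.
move=> lV ch lh w1 wL Vh FG; apply: unif_limitK => e e0.
have [N HN] := riemann_sum ch lh w1 wL e0.
exists (fun x => \sum_(i < N)
    N%:R^-1 * (w (i%:R / N%:R) * h (c x + i%:R / N%:R * d x))).
  have lV' := unif_limit_lin lV.
  apply: lin_space_sum => // i _.
  exact: (lin_spaceZ _ lV' (lin_spaceZ _ lV' (Vh _))).
by move=> x; have [G [-> dG]] := FG x; exact: HN.
Qed.

End Dilates.

(** * Translates and dilates of a function with equal limits *)

Section DilatesBump.
Context {R : realType}.
Variables (phi : R -> R) (c : R).
Hypothesis phi_cont : continuous phi.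
Hypothesis phi_lim : end_limits phi c c.
Hypothesis phi_nonconst : ~ exists k : R, forall x : R, phi x = k.

Let W := unif_limit (dilates phi).

Lemma dilates_lin : lin_space W.
Proof. by apply: unif_limit_lin; exact: lspan_lin. Qed.

Lemma dilates_base a b : W (fun t => phi (a * t + b)).
Proof. by apply: sub_unif_limit; apply: sub_lspan; exists a, b. Qed.

Lemma dilates_affine h a b : W h -> W (fun t => h (a * t + b)).
Proof.
apply: dilates_comp; first exact: lspan_lin.
move=> a' b'; apply: set_ext (dilates_base (a' * a) (a' * b + b')) _ => t.
by congr phi; ring.
Qed.

Lemma dilates_cst k : W (fun=> k).
Proof.
have [b phib] : exists b, phi b != 0.
  apply: contrapT => H; apply: phi_nonconst; exists 0 => x; apply/eqP.
  by apply: contrapT => /negP phix; apply: H; exists x.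
apply: set_ext (lin_spaceZ (k / phi b) dilates_lin (dilates_base 0 b)) _ => t.
by rewrite mul0r add0r divfK.
Qed.

(** A second difference is taken because its second antiderivative can be chosen as a second
    difference too, and therefore to vanish at both ends. *)
Let h x := phi (x + 2) - 2 * phi (x + 1) + phi x.

Let h_W : W h.
Proof.
have H a : W (fun x => phi (x + a)).
  by apply: set_ext (dilates_base 1 a) _ => t; rewrite mul1r.
have H2 := lin_spaceZ 2 dilates_lin (H 1).
apply: set_ext (lin_spaceD dilates_lin (lin_spaceB dilates_lin (H 2) H2) (H 0)) _.
by move=> x; rewrite addr0.
Qed.

Let h_cont : continuous h := dilates_continuous phi_cont h_W.

Let h_lim : end_limits h 0 0.
Proof.
move=> e e0; have e4 : 0 < e / 4 by rewrite divr_gt0.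
have [A A0 hA] := phi_lim e4; exists (A + 2); first by rewrite addr_gt0.
move=> x; split=> xA.
  have h0 : A <= x by lra.
  have h1 : A <= x + 1 by lra.
  have h2 : A <= x + 2 by lra.
  move: ((hA _).1 h0) ((hA _).1 h1) ((hA _).1 h2); rewrite /h !ler_norml.
  by move=> /andP[? ?] /andP[? ?] /andP[? ?]; apply/andP; split; lra.
have h0 : x <= - A by lra.
have h1 : x + 1 <= - A by lra.
have h2 : x + 2 <= - A by lra.
move: ((hA _).2 h0) ((hA _).2 h1) ((hA _).2 h2); rewrite /h !ler_norml.
by move=> /andP[? ?] /andP[? ?] /andP[? ?]; apply/andP; split; lra.
Qed.

(** Second differences commute with differentiation. With [Q] a second antiderivative of [phi - c],
    two applications of the mean value theorem bound [D2 Q x] by twice a bound of [|phi - c|] on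
    [[x, x + 2]], which tends to [0]. *)
Let ex_second_primitive : exists f1 f2 : R -> R,
  [/\ forall x : R, is_derive x 1 f2 (f1 x),
      forall x : R, is_derive x 1 f1 (h x) & end_limits f2 0 0].
Proof.
have cpsi : continuous (fun x => phi x - c).
  by move=> x; apply: cvgB; [exact: phi_cont|exact: cvg_cst].
have [P dP] := ex_antiderivative cpsi.
have cP : continuous P.
  by move=> x; apply: differentiable_continuous; apply/derivable1_diffP; have [] := dP x.
have [Q dQ] := ex_antiderivative cP.
have shift (F F' : R -> R) : (forall x : R, is_derive x 1 F (F' x)) ->
    forall a x : R, is_derive x 1 (fun y => F (y + a)) (F' (x + a)).
  move=> dF a x.
  apply: is_derive_eq (@is_derive1_comp _ F (fun y => y + a) x _ _ (dF _)
    (derive1D (derive1_id x) (derive1_cst a x))) _.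
  by rewrite addr0 mulr1.
pose D2 (F : R -> R) x := F (x + 2) - 2 * F (x + 1) + F x.
have dD2 (F F' : R -> R) : (forall x : R, is_derive x 1 F (F' x)) ->
    forall x : R, is_derive x 1 (D2 F) (D2 F' x).
  move=> dF x.
  exact: derive1D (derive1B (shift _ _ dF 2 x) (derive1Z 2 (shift _ _ dF 1 x)))
    (dF x).
exists (D2 P), (D2 Q); split.
- exact: dD2.
- move=> x; apply: is_derive_eq (dD2 _ _ dP x) _; rewrite /D2 /h; ring.
have key x e : (forall y, x <= y <= x + 2 -> `|phi y - c| <= e) ->
    `|D2 Q x| <= 2 * e.
  move=> He.
  have x1 : x < x + 1 by lra.
  have x2 : x + 1 < x + 2 by lra.
  have [z1 /andP[z11 z12] E1] := MVT1 x1 (fun z _ => dQ z).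
  have [z2 /andP[z21 z22] E2] := MVT1 x2 (fun z _ => dQ z).
  have -> : D2 Q x = P z2 - P z1.
    rewrite /D2; have -> : Q (x + 2) - 2 * Q (x + 1) + Q x =
      (Q (x + 2) - Q (x + 1)) - (Q (x + 1) - Q x) by ring.
    by rewrite E1 E2; ring.
  have e0 : 0 <= e.
    apply: le_trans (normr_ge0 (phi x - c)) (He x _).
    by apply/andP; split; lra.
  have : z1 <= z2 by lra.
  rewrite le_eqVlt => /orP[/eqP ->|z12'].
    by rewrite subrr normr0 mulr_ge0.
  have [z3 /andP[z31 z32] ->] := MVT1 z12' (fun z _ => dP z).
  rewrite normrM mulrC; apply: ler_pM => //.
    by rewrite gtr0_norm; lra.
  by apply: He; apply/andP; split; lra.
move=> e e0; have e2 : 0 < e / 2 by rewrite divr_gt0.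
have [A A0 hA] := phi_lim e2; exists (A + 2); first by rewrite addr_gt0.
move=> x; rewrite subr0; have -> : e = 2 * (e / 2) by field.
split=> xA; apply: key => y /andP[y1 y2].
  by apply: (hA y).1; lra.
by apply: (hA y).2; lra.
Qed.

(* Otherwise [phi], being bounded and affine along every progression of step 1,
   would be constant. *)
Let h_neq0 : ~ forall x, h x = 0.
Proof.
move=> h0; apply: phi_nonconst; exists c.
have [C C0 phiC] := end_limits_bounded phi_cont phi_lim.
have aff x n : phi (x + n%:R) = phi x + n%:R * (phi (x + 1) - phi x).
  suff : phi (x + n%:R) = phi x + n%:R * (phi (x + 1) - phi x) /\
    phi (x + n.+1%:R) = phi x + n.+1%:R * (phi (x + 1) - phi x) by case.
  elim: n => [|n [IH1 IH2]].
    by rewrite mulr0n mul0r !addr0 mulr1n mul1r; split => //; ring.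
  split => //; have := h0 (x + n%:R); rewrite /h.
  have -> : x + n%:R + 2 = x + n.+2%:R by rewrite -addrA -[in RHS]addn2 natrD.
  have -> : x + n%:R + 1 = x + n.+1%:R by rewrite -addrA -[in RHS]addn1 natrD.
  move=> H.
  have -> : phi (x + n.+2%:R) = 2 * phi (x + n.+1%:R) - phi (x + n%:R).
    by move: H; move: (phi _) (phi _) (phi _) => u v w; lra.
  rewrite IH1 IH2.
  have -> : n.+2%:R = n%:R + 2 :> R by rewrite -addn2 natrD.
  have -> : n.+1%:R = n%:R + 1 :> R by rewrite -addn1 natrD.
  by ring.
have per x : phi (x + 1) = phi x.
  apply/eqP; rewrite -subr_eq0; apply/eqP; apply: contrapT => /eqP ne.
  have nd : 0 < `|phi (x + 1) - phi x| by rewrite normr_gt0.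
  pose n := (Num.truncn `|2 * C / `|phi (x + 1) - phi x| |).+1.
  have : 2 * C / `|phi (x + 1) - phi x| < n%:R by exact: truncn_bound.
  rewrite ltr_pdivrMr // -[n%:R]ger0_norm ?ler0n // -normrM.
  have -> : n%:R * (phi (x + 1) - phi x) = phi (x + n%:R) - phi x.
    by rewrite aff; ring.
  apply/negP; rewrite -leNgt; apply: le_trans (ler_normB _ _) _.
  by move: (phiC (x + n%:R)) (phiC x); lra.
(* By periodicity [phi x] is also the value of [phi] at points arbitrarily far to the right, so it
   equals the limit [c]. *)
move=> x; apply/eqP; rewrite -subr_eq0 -normr_le0.
apply/ler_addgt0Pl => e e0; rewrite addr0.
have [A A0 hA] := phi_lim e0.
pose n := (Num.truncn `|A - x|).+1.
have : phi (x + n%:R) = phi x by rewrite aff per; ring.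
move=> <-; apply: (hA _).1; rewrite addrC -lerBlDr ltW //; exact: truncn_bound.
Qed.

(* The average of the translate-dilates [h (b + a x)] with weight [1 - a] on
   [0, 1] is [(f2 (b + x) - f2 b) / x^2] by Taylor's formula; it has a constant
   sign and is integrable because [f2] is extremal at [b]. *)
Lemma dilates_ex_bump : exists S : R -> R, [/\ W S, forall x, 0 <= S x,
  exists x, 0 < S x & exists2 K : R, 0 < K & forall x, S x * x ^+ 2 <= K].
Proof.
have [f1 [f2 [d2 d1 f2l]]] := ex_second_primitive.
have cf2 : continuous f2.
  by move=> x; apply: differentiable_continuous; apply/derivable1_diffP; have [] := d2 x.
(* The sign [s], equal to [1] or [-1], covers at once the cases where [f2] takes a positive value
   and where it takes only negative nonzero ones near the chosen point: [s * f2] has a positive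
   maximum at [b]. *)
have [s [b [s2 fb fmax]]] : exists s b, [/\ s ^+ 2 = 1, 0 < s * f2 b &
    forall x, s * f2 x <= s * f2 b].
  have [x0 f2x0] : exists x0, f2 x0 != 0.
    apply: contrapT => H; apply: h_neq0 => x.
    have f20 y : f2 y = 0.
      by apply/eqP; apply: contrapT => /negP fy; apply: H; exists y.
    have f2E : f2 = cst 0 by apply/funext.
    have f10 y : f1 y = 0.
      by apply: derive1_unique (d2 y) _; rewrite f2E; exact: is_derive_cst.
    have f1E : f1 = cst 0 by apply/funext.
    by apply: derive1_unique (d1 x) _; rewrite f1E; exact: is_derive_cst.
  case: (ltgtP (f2 x0) 0) f2x0 => // f2x0 _.
    have cN : continuous (fun x => - f2 x) by move=> x; apply: cvgN; exact: cf2.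
    have lN : end_limits (fun x => - f2 x) 0 0.
      move=> e e0; have [A A0 hA] := f2l _ e0; exists A => // x.
      by have := hA x; rewrite !subr0 normrN.
    have p0 : 0 < - f2 x0 by rewrite oppr_gt0.
    have [b fb fmax] := end_limits_max_attained cN lN p0.
    exists (-1), b; split; [by rewrite sqrrN expr1n|by rewrite mulN1r|].
    by move=> x; rewrite !mulN1r.
  have [b fb fmax] := end_limits_max_attained cf2 f2l f2x0.
  by exists 1, b; split; [rewrite expr1n|rewrite mul1r|move=> x; rewrite !mul1r].
have s0 : s != 0.
  apply/eqP => sE; move: s2; rewrite sE expr0n => /esym/eqP.
  by rewrite oner_eq0.
have ds2 (x : R) : is_derive x 1 (fun y => s * f2 y) (s * f1 x) by apply: derive1Z.
have f1b : f1 b = 0.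
  have : s * f1 b = 0.
    apply: derive1_unique (ds2 b) _.
    apply: (@derive1_at_max _ _ (b - 1) (b + 1)).
    - by lra.
    - by move=> t _; have [] := ds2 t.
    - by rewrite in_itv /=; apply/andP; split; lra.
    - by move=> t _; exact: fmax.
  by move=> /eqP; rewrite mulf_eq0 (negbTE s0) => /eqP.
(* The value at [0] is the average of the constant [h b] with weight [1 - u] over [[0, 1]]. *)
pose S0 x := if x == 0 then h b / 2 else (f2 (b + x) - f2 b) / x ^+ 2.
pose S x := - s * S0 x.
have WS : W S.
  suff WS0 : W S0 by exact: (lin_spaceZ (- s) dilates_lin WS0).
  apply: unif_limitK.
  apply: (@riemann_unif_limit _ _ _ h (fun u => 1 - u) (fun=> b) id).
  - exact: dilates_lin.
  - exact: h_cont.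
  - exact: h_lim.
  - by move=> u /andP[u0 u1]; rewrite ler_norml; apply/andP; split; lra.
  - move=> u v; have -> : 1 - u - (1 - v) = - (u - v) by ring.
    by rewrite normrN.
  - move=> u; apply: sub_unif_limit.
    by apply: set_ext (dilates_affine u b h_W) _ => x; rewrite addrC.
  rewrite /S0 => x; case: eqP => [->|/eqP x0].
    exists (fun u => (u - u * u / 2) * h b); split; first by field.
    move=> u _; rewrite mulr0 addr0.
    apply: is_derive_eq (derive1M (derive1B (derive1_id u)
      (derive1M (derive1M (derive1_id u) (derive1_id u))
        (derive1_cst (2^-1) u))) (derive1_cst (h b) u)) _.
    by rewrite /=; field.
  (* This primitive comes from integrating by parts; its boundary term at [u = 0] contains [f1 b],
     which vanishes because [b] is an extremum of [f2]. *)
  exists (fun u => (1 - u) * f1 (b + u * x) / x + f2 (b + u * x) / x ^+ 2).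
  split; first by rewrite mul0r !addr0 f1b mul1r; field.
  move=> u _.
  have e1 := derive1_affine (d1 (b + u * x)).
  have e2 := derive1_affine (d2 (b + u * x)).
  apply: is_derive_eq (derive1D (derive1M (derive1M (derive1B
    (derive1_cst 1 u) (derive1_id u)) e1) (derive1_cst x^-1 u))
    (derive1M e2 (derive1_cst (x ^+ 2)^-1 u))) _.
  by rewrite /=; field.
have cS := dilates_continuous phi_cont WS.
have [C C0 f2C] := end_limits_bounded cf2 f2l.
have SE x : x != 0 -> S x = (s * f2 b - s * f2 (b + x)) / x ^+ 2.
  by move=> x0; rewrite /S /S0 (negbTE x0); field.
have Sge x : x != 0 -> 0 <= S x.
  by move=> x0; rewrite SE // divr_ge0 ?sqr_ge0 // subr_ge0.
have ns : `|s| = 1.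
  by apply/eqP; rewrite -sqrp_eq1 ?normr_ge0 // real_normK ?num_real // s2.
exists S; split => //.
(* At [0] the sign follows from continuity of [S] and the sign at nearby nonzero points. *)
- move=> x; have [->|] := eqVneq x 0; last exact: Sge.
  rewrite leNgt; apply/negP => Sneg.
  have SN0 : 0 < - S 0 by rewrite oppr_gt0.
  have /cvgrPdist_lt /(_ _ SN0) := cS 0.
  rewrite -nbhs_ballE => -[d /= d0 dP].
  have := dP (d / 2); rewrite -ball_normE /= sub0r normrN gtr0_norm ?divr_gt0 //.
  have -> : d / 2 < d by lra.
  move=> /(_ isT); have : 0 <= S (d / 2) by apply: Sge; rewrite gt_eqF // divr_gt0.
  move=> h1; rewrite ltr_norml => /andP[h2 _]; lra.
(* Far away [s * f2] falls below half of its maximum, which makes [S] strictly positive there. *)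
- have fb2 : 0 < s * f2 b / 2 by rewrite divr_gt0.
  have [A A0 hA] := f2l _ fb2.
  pose x := A + `|b|.
  have x0 : 0 < x by rewrite ltr_wpDr.
  exists x; rewrite SE ?gt_eqF // divr_gt0 ?exprn_gt0 // subr_gt0.
  apply: le_lt_trans (ler_norm _) _; rewrite normrM ns mul1r.
  have : `|f2 (b + x) - 0| <= s * f2 b / 2.
    by apply: (hA _).1; rewrite /x; move: (ler_norm (- b)); rewrite normrN; lra.
  by rewrite subr0; lra.
- exists (2 * C); first by rewrite mulr_gt0.
  move=> x; have [->|x0] := eqVneq x 0; first by rewrite expr0n mulr0 mulr_ge0 // ltW.
  rewrite SE // divfK ?expf_neq0 //.
  have := ler_norm (s * f2 b); have := ler_norm (- (s * f2 (b + x))).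
  rewrite normrN !normrM ns !mul1r; move: (f2C b) (f2C (b + x)); lra.
Qed.

End DilatesBump.

Section DilatesDense.
Context {R : realType}.

(** Since [S <= K / x ^+ 2], the function [Q + K / x] is nonincreasing on each side beyond [1] and
    [-1], which bounds the nondecreasing [Q] and gives it finite limits. If these coincided, [Q]
    would be constant, against [S] being positive somewhere. *)
Lemma bump_primitive_sigmoid (S Q : R -> R) (K : R) : 0 < K ->
  (forall x : R, is_derive x 1 Q (S x)) -> (forall x, 0 <= S x) ->
  (exists x, 0 < S x) -> (forall x, S x * x ^+ 2 <= K) ->
  exists l r, l < r /\ end_limits Q l r.
Proof.
move=> K0 dQ S0 [y0 Sy0] SK.
have Qm : {homo Q : x y / x <= y}.
  move=> x y; rewrite le_eqVlt => /orP[/eqP -> //|xy].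
  have [z _ E] := MVT1 xy (fun z _ => dQ z).
  by rewrite -subr_ge0 E mulr_ge0 // subr_ge0 ltW.
pose P x := Q x + K * x^-1.
have Pd x y : x < y -> (1 <= x) || (y <= -1) -> P y <= P x.
  move=> xy h; rewrite -subr_le0.
  have nz z : x <= z <= y -> z != 0.
    by move: h => /orP[] h /andP[? ?]; [rewrite gt_eqF|rewrite lt_eqF] => //; lra.
  have dP z : x <= z <= y -> is_derive z 1 P (S z - K / z ^+ 2).
    move=> /nz z0.
    apply: is_derive_eq (derive1D (dQ z)
      (derive1Z K (derive1V (f := fun y => y) z0 (derive1_id z)))) _.
    by rewrite mulN1r mulrN.
  have [z /nz z0 ->] := MVT1 xy dP.
  rewrite mulr_le0_ge0 ?subr_ge0 ?(ltW xy) // subr_le0.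
  by rewrite ler_pdivlMr // exprn_even_gt0.
have Qu x : Q x <= Q 1 + K.
  have [x1|x1] := lerP x 1; first by apply: le_trans (Qm _ _ x1) _; lra.
  have := Pd _ _ x1; rewrite lexx /P invr1 => /(_ isT).
  have : 0 < K * x^-1 by rewrite mulr_gt0 // invr_gt0; lra.
  lra.
have Ql x : Q (-1) - K <= Q x.
  have [x1|x1] := lerP (-1) x; first by apply: le_trans (Qm _ _ x1); lra.
  have := Pd _ _ x1; rewrite lexx orbT /P invrN1 => /(_ isT).
  have : K * x^-1 < 0 by rewrite pmulr_rlt0 // invr_lt0; lra.
  lra.
have QB x : `|Q x| <= `|Q 1| + `|Q (-1)| + K.
  have := Qu x; have := Ql x; move: (ler_norm (Q 1)) (ler_norm (- Q (-1))).
  rewrite normrN; move: (normr_ge0 (Q 1)) (normr_ge0 (Q (-1))) => ? ? ? ? ? ?.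
  by rewrite ler_norml; apply/andP; split; lra.
have [l [r [lQ lr]]] := nondecreasing_end_limits Qm QB.
exists l, r; split => //; rewrite lt_neqAle.
have -> : l <= r by have /andP[] := lr 0; exact: le_trans.
rewrite andbT; apply/eqP => lE.
have QE : Q = cst l.
  apply/funext => x; apply/eqP; rewrite eq_le /=.
  by have := lr x; rewrite -lE andbC.
have dQ0 : is_derive y0 1 Q 0 by rewrite QE; exact: is_derive_cst.
by move: Sy0; rewrite (derive1_unique (dQ y0) dQ0) ltxx.
Qed.

(** The primitive [Q] of the bump is a sigmoid but need not lie in the closure; only differences of
    its translates do, as averages of the bump. This suffices, because for [g] vanishing at both
    ends the weights of the sigmoid approximation sum to [0]. *)
Lemma dilates_dense (phi : R -> R) (c : R) (g : R -> R) :
  continuous phi -> end_limits phi c c ->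
  ~ (exists k : R, forall x : R, phi x = k) ->
  continuous g -> end_limits g 0 0 -> unif_limit (dilates phi) g.
Proof.
move=> cphi lphi nphi cg lg.
have [S [WS S0 Sp [K K0 SK]]] := dilates_ex_bump cphi lphi nphi.
have cS := dilates_continuous cphi WS.
have lS : end_limits S 0 0.
  move=> e e0; pose A := K / e + 1.
  have Ke : 0 < K / e by rewrite divr_gt0.
  have key x : A <= `|x| -> `|S x - 0| <= e.
    move=> Ax; rewrite subr0 ger0_norm //.
    have x1 : 1 <= `|x| by apply: le_trans Ax; rewrite /A; lra.
    have x2 : 0 < x ^+ 2.
      by rewrite -[x ^+ 2]real_normK ?num_real // exprn_gt0 // (lt_le_trans ltr01).
    rewrite -(ler_pM2r x2); apply: le_trans (SK x) _.
    rewrite -[x ^+ 2]real_normK ?num_real //.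
    have h1 : K / e <= `|x| ^+ 2.
      by apply: le_trans (_ : `|x| <= _); [rewrite /A in Ax; lra|rewrite expr2 ler_peMl].
    by move: h1; rewrite ler_pdivrMr // mulrC.
  exists A; first by rewrite /A; lra.
  move=> x; split=> h; apply: key; first exact: le_trans h (ler_norm x).
  by rewrite -normrN; apply: le_trans (ler_norm _); lra.
have [Q dQ] := ex_antiderivative cS.
have [l [r [lr lQ]]] := bump_primitive_sigmoid K0 dQ S0 Sp SK.
have lW := @dilates_lin R phi.
have QW a b b' : unif_limit (dilates phi) (fun t => Q (a * t + b) - Q (a * t + b')).
  have [->|bb] := eqVneq b b'.
    by apply: set_ext lW.1 _ => t; rewrite subrr.
  have bb0 : b - b' != 0 by rewrite subr_eq0.
  suff H : unif_limit (dilates phi)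
      (fun t => (Q (a * t + b) - Q (a * t + b')) / (b - b')).
    apply: set_ext (lin_spaceZ (b - b') lW H) _ => t.
    by rewrite mulrC divfK.
  apply: unif_limitK.
  apply: (@riemann_unif_limit _ _ _ S (fun=> 1) (fun t => a * t + b') (fun=> b - b')) => //.
  - by move=> u _; rewrite normr1.
  - by move=> u v; rewrite subrr normr0.
  - move=> u; apply: sub_unif_limit.
    by apply: set_ext (dilates_affine a (b' + u * (b - b')) WS) _ => t; rewrite addrA.
  - move=> x; exists (fun u => Q (a * x + b' + u * (b - b')) / (b - b')); split.
      by rewrite mul1r mul0r addr0 -addrA (addrC b') subrK mulrBl.
    move=> u _.
    apply: is_derive_eq (derive1M (derive1_affine (dQ _)) (derive1_cst (b - b')^-1 u)) _.
    by field.
pose s x := (Q x - l) / (r - l).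
have rl0 : 0 < r - l by rewrite subr_gt0.
have ls : end_limits s 0 1.
  move=> e e0; have er : 0 < e * (r - l) by rewrite mulr_gt0.
  have [A A0 hA] := lQ _ er; exists A => // x; split=> h.
    have -> : s x - 1 = (Q x - r) / (r - l) by rewrite /s; field; rewrite gt_eqF.
    by rewrite normrM normfV (gtr0_norm rl0) ler_pdivrMr //; exact: (hA x).1.
  rewrite subr0 normrM normfV (gtr0_norm rl0) ler_pdivrMr //; exact: (hA x).2.
have cQ : continuous Q.
  by move=> x; apply: differentiable_continuous; apply/derivable1_diffP; have [] := dQ x.
have cs : continuous s.
  by move=> x; apply: cvgM; [apply: cvgB; [exact: cQ|exact: cvg_cst]|exact: cvg_cst].
apply: unif_limitK => e e0.
have [m [a [t [d [sd gd]]]]] := sigmoid_approx cs ls cg lg e0.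
exists (fun x => 0 + \sum_(i < m) d i * s (a * (x - t i))); last exact: gd.
apply: (@set_ext _ _ _ (fun x => \sum_(i < m)
    (d i / (r - l)) * (Q (a * x + (- a * t i)) - Q (a * x + 0)))).
  by apply: lin_space_sum => // i _; apply: (lin_spaceZ _ lW (QW _ _ _)).
move=> x; rewrite add0r.
(* The weights have sum [0], so a common multiple of [s (a * x)] may be subtracted; every summand
   becomes a difference of two translates of [Q (a * x)]. *)
have -> : \sum_(i < m) d i * s (a * (x - t i)) =
  \sum_(i < m) d i * s (a * (x - t i)) - (\sum_(i < m) d i) * s (a * x).
  by rewrite sd subrr mul0r subr0.
rewrite mulr_suml -sumrB; apply: eq_bigr => i _.
have -> : a * (x - t i) = a * x + - a * t i by ring.
by rewrite /s addr0; field; rewrite gt_eqF.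
Qed.

Lemma end_limitsB (f : R -> R) l r k :
  end_limits f l r -> end_limits (fun x => f x - k) (l - k) (r - k).
Proof.
move=> lf e e0; have [A A0 hA] := lf _ e0; exists A => // x.
have E z : f x - k - (z - k) = f x - z by ring.
by rewrite !E; exact: hA.
Qed.

Lemma dilates_dense_cst (phi : R -> R) (c : R) (g : R -> R) k :
  continuous phi -> end_limits phi c c ->
  ~ (exists k : R, forall x : R, phi x = k) ->
  continuous g -> end_limits g k k -> unif_limit (dilates phi) g.
Proof.
move=> cphi lphi nphi cg lg.
have cg' : continuous (fun x => g x - k).
  by move=> x; apply: cvgB; [exact: cg|exact: cvg_cst].
have := end_limitsB k lg; rewrite subrr => /(dilates_dense cphi lphi nphi cg') H.
apply: set_ext (lin_spaceD (@dilates_lin R phi) H (dilates_cst nphi k)) _ => x.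
by rewrite subrK.
Qed.

End DilatesDense.

(** * Uniform algebras *)

Definition bounded_fct (R : realType) (T : Type) (f : T -> R) : Prop :=
  exists2 M : R, 0 < M & forall x, `|f x| <= M.

(** These are the uniformly closed unital algebras of bounded functions. Boundedness makes products
    compatible with uniform limits and confines the values of a function in compositions. *)
Record unif_algebra (R : realType) (T : Type) (B : set (T -> R)) : Prop := {
  unif_algebra_lin : lin_space B;
  unif_algebra_cst : forall k, B (fun=> k);
  unif_algebra_mul : forall f g, B f -> B g -> B (fun x => f x * g x);
  unif_algebra_lim : unif_limit B `<=` B;
  unif_algebra_bounded : forall f, B f -> bounded_fct f }.

Section UniformAlgebras.
Context {R : realType} {T : Type}.
Implicit Types (S B : set (T -> R)) (f g : T -> R).

Lemma bounded_unif_limit S f : (forall g, S g -> bounded_fct g) ->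
  unif_limit S f -> bounded_fct f.
Proof.
move=> bS /(_ 1 ltr01) [g /bS [M M0 gM] fg]; exists (1 + M); first exact: addr_gt0.
move=> x; rewrite -[f x](subrK (g x)); apply: le_trans (ler_normD _ _) _.
exact: lerD.
Qed.

Lemma bounded_lin : lin_space [set f : T -> R | bounded_fct f].
Proof.
split; first by exists 1 => // x; rewrite normr0.
move=> c f g [M M0 fM] [N N0 gN]; exists (`|c| * M + N).
  by rewrite ltr_wpDl // mulr_ge0 // ltW.
move=> x; apply: le_trans (ler_normD _ _) _; rewrite normrM lerD //.
exact: ler_wpM2l.
Qed.

Lemma unif_limit_mulr S B f : lin_space B -> bounded_fct f ->
  (forall g, S g -> unif_limit B (fun x => f x * g x)) ->
  forall g, unif_limit S g -> unif_limit B (fun x => f x * g x).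
Proof.
move=> lB [M M0 fM] SB g gS; apply: unif_limitK => e e0.
have eM : 0 < e / M by rewrite divr_gt0.
have [k Sk gk] := gS _ eM; exists (fun x => f x * k x); first exact: SB.
move=> x; rewrite -mulrBr normrM -[e](divfK (lt0r_neq0 M0)) mulrC.
exact: ler_pM.
Qed.

(** Closure under products passes from generators to their span by linearity and then to limits by
    boundedness, in one factor at a time. *)
Lemma lspan_unif_algebra S : (forall f, S f -> bounded_fct f) ->
  (forall k, unif_limit (lspan S) (fun=> k)) ->
  (forall f g, S f -> S g -> unif_limit (lspan S) (fun x => f x * g x)) ->
  unif_algebra (unif_limit (lspan S)).
Proof.
move=> bS cS mS.
have lU := unif_limit_lin (@lspan_lin _ _ S).
have bU f : unif_limit (lspan S) f -> bounded_fct f.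
  by apply: bounded_unif_limit; exact: lspan_sub bounded_lin bS.
split => // [f g|]; last by move=> f; exact: unif_limitK.
have step (h : T -> R) : (forall k, S k -> unif_limit (lspan S) (fun x => h x * k x)) ->
    forall k, lspan S k -> unif_limit (lspan S) (fun x => h x * k x).
  move=> Sh; apply: lspan_sub => //; split.
    by apply: set_ext lU.1 _ => x; rewrite mulr0.
  move=> c k k' hk hk'; apply: set_ext (lU.2 c _ _ hk hk') _ => x /=; ring.
have Sf h k : S h -> unif_limit (lspan S) k ->
    unif_limit (lspan S) (fun x => h x * k x).
  move=> Sh; apply: unif_limit_mulr; [exact: lspan_lin|exact: bS|].
  by apply: step => k' Sk'; exact: mS.
move=> Uf Ug.
apply: (@set_ext _ _ _ (fun x => g x * f x)); last by move=> x; exact: mulrC.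
apply: (unif_limit_mulr _ _ _ Uf); [exact: lspan_lin|exact: bU|].
apply: step => k Sk; apply: set_ext (Sf _ _ Sk Ug) _ => x; exact: mulrC.
Qed.

Variable B : set (T -> R).
Hypothesis aB : unif_algebra B.

(** This is the Neumann series: with [M] an upper bound of [f] and [y = 1 - f / M], the values of
    [y] stay in [[0, rho]] with [rho < 1], so the partial sums of [M^-1 * \sum_i y ^+ i] converge
    uniformly to the inverse. *)
Lemma unif_algebra_inv f (dl : R) : B f -> 0 < dl -> (forall x, dl <= f x) ->
  B (fun x => (f x)^-1).
Proof.
move=> Bf dl0 fdl.
have [lB cB mB limB bB] := aB.
have [M0 M00 fM0] := bB _ Bf.
pose M := M0 + dl; have M_gt0 : 0 < M by rewrite addr_gt0.
have fM x : f x <= M by move: (ler_norm (f x)) (fM0 x); rewrite /M; lra.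
pose y x := 1 - f x / M.
have By : B y.
  apply: lin_spaceB => //; apply: set_ext (lin_spaceZ M^-1 lB Bf) _ => x.
  exact: mulrC.
have BX k : B (fun x => y x ^+ k).
  elim: k => [|k IH]; first by apply: set_ext (cB 1) _ => x; rewrite expr0.
  by apply: set_ext (mB _ _ By IH) _ => x; rewrite exprS.
pose rho := 1 - dl / M.
have y_ge0 x : 0 <= y x by rewrite /y subr_ge0 ler_pdivrMr // mul1r.
have y_rho x : y x <= rho.
  by rewrite /y /rho lerD2l lerN2 ler_pM2r ?invr_gt0.
have rho_lt1 : `|rho| < 1.
  have : 0 < dl / M by rewrite divr_gt0.
  have : dl / M <= 1 by rewrite ler_pdivrMr // mul1r /M; lra.
  by move=> ? ?; rewrite /rho ltr_norml; apply/andP; split; lra.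
apply: limB => e e0.
have ed : 0 < e * dl by rewrite mulr_gt0.
have [N _ HN] : \forall N \near \oo, `|rho ^+ N| < e * dl.
  have /cvgrPdist_lt /(_ _ ed) := cvg_expr rho_lt1.
  by apply: filterS => N; rewrite sub0r normrN.
exists (fun x => M^-1 * \sum_(i < N) y x ^+ i).
  by apply: lin_spaceZ => //; apply: lin_space_sum.
move=> x; have fx0 : 0 < f x := lt_le_trans dl0 (fdl x).
have yE : f x = M * (1 - y x) by rewrite /y; field; rewrite gt_eqF.
have -> : (f x)^-1 - M^-1 * \sum_(i < N) y x ^+ i = y x ^+ N / f x.
  have S1 : (1 - y x) * \sum_(i < N) y x ^+ i = 1 - y x ^+ N.
    by rewrite -[in RHS](expr1n _ N) subrXX; congr (_ * _);
      apply: eq_bigr => i _; rewrite expr1n mul1r.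
  have -> : y x ^+ N = 1 - (1 - y x) * \sum_(i < N) y x ^+ i by rewrite S1; ring.
  have y1 : 1 - y x = f x / M by rewrite yE; field; rewrite gt_eqF.
  by rewrite y1; field; rewrite !gt_eqF.
rewrite normrM normfV (gtr0_norm fx0) ler_pdivrMr //.
apply: le_trans (_ : e * dl <= _); last by rewrite ler_pM2l.
apply: le_trans (ltW (HN N _)); last exact: leqnn.
rewrite !normrX lerXn2r ?nnegrE // !ger0_norm //; exact: le_trans (y_rho x).
Qed.

End UniformAlgebras.

(** * The rational bump and Feynman's formula *)

Section RationalBump.
Context {R : realType}.

Definition rbump (t : R) : R := (1 + t ^+ 2)^-1.
(** The real part of [1 / (t - i)^2], whereas [rbump] is the imaginary part of [1 / (t - i)]. *)
Definition rbump2 (t : R) : R := (t ^+ 2 - 1) / (1 + t ^+ 2) ^+ 2.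

Lemma sqr1_gt0 (t : R) : 0 < 1 + t ^+ 2.
Proof. by rewrite ltr_pwDl // sqr_ge0. Qed.

Lemma decay_end_limits (h : R -> R) :
  (forall t, `|h t| * (1 + t ^+ 2) <= 1) -> end_limits h 0 0.
Proof.
move=> hd e e0; have ie : 0 < e^-1 by rewrite invr_gt0.
exists (e^-1 + 1); first exact: addr_gt0.
have key x : e^-1 + 1 <= `|x| -> `|h x - 0| <= e.
  move=> xe; rewrite subr0 -(ler_pM2r (sqr1_gt0 x)).
  apply: le_trans (hd x) _; rewrite -[x ^+ 2]real_normK ?num_real //.
  have h1 : e * (e^-1 + 1) <= e * `|x| by rewrite ler_pM2l.
  have h2 : e * `|x| <= e * `|x| ^+ 2 by rewrite ler_pM2l // expr2 ler_peMl //; lra.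
  have : e * (e^-1 + 1) = 1 + e by field; rewrite gt_eqF.
  lra.
move=> x; split=> hx; apply: key; first exact: le_trans hx (ler_norm x).
by rewrite -normrN; apply: le_trans (ler_norm _); lra.
Qed.

Lemma rbump_end_limits : end_limits rbump 0 0.
Proof.
apply: decay_end_limits => t; rewrite gtr0_norm ?invr_gt0 ?sqr1_gt0 //.
by rewrite /rbump mulVf // gt_eqF // sqr1_gt0.
Qed.

Lemma rbump2_end_limits : end_limits rbump2 0 0.
Proof.
apply: decay_end_limits => t; have t0 := sqr1_gt0 t.
have -> : `|rbump2 t| * (1 + t ^+ 2) = `|t ^+ 2 - 1| / (1 + t ^+ 2).
  rewrite /rbump2 normrM normfV (ger0_norm (sqr_ge0 _)).
  by field; rewrite gt_eqF.
rewrite ler_pdivrMr // mul1r ler_norml; have := sqr_ge0 t.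
by move=> ?; apply/andP; split; lra.
Qed.

Lemma rbump_cont : continuous rbump.
Proof.
move=> x; apply: cvgV; first by rewrite gt_eqF // sqr1_gt0.
by apply: cvgD; [exact: cvg_cst|exact: exprn_continuous].
Qed.

Lemma rbump2_cont : continuous rbump2.
Proof.
move=> x; apply: cvgM.
  by apply: cvgB; [exact: exprn_continuous|exact: cvg_cst].
have cs : (fun t : R => 1 + t ^+ 2) y @[y --> x] --> 1 + x ^+ 2.
  by apply: cvgD; [exact: cvg_cst|exact: exprn_continuous].
apply: cvgV; first by rewrite expf_neq0 // gt_eqF // sqr1_gt0.
by rewrite !expr2; apply: cvgM.
Qed.

Lemma rbump_nonconst : ~ exists k : R, forall x : R, rbump x = k.
Proof.
move=> [k H]; have := H 0; rewrite -(H 1) /rbump expr0n expr1n addr0 invr1.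
by move/(congr1 GRing.inv); rewrite invr1 invrK; lra.
Qed.

(* Real part of Feynman's formula
   1 / ((u - i) (v - i)) = \int_0^1 d th / (v + th (u - v) - i)^2. *)
Lemma feynman_unif_limit (T : Type) (V : set (T -> R)) (u v : T -> R) :
  lin_space V ->
  (forall th, unif_limit V (fun x => rbump2 (v x + th * (u x - v x)))) ->
  unif_limit V (fun x => (u x * v x - 1) / ((1 + u x ^+ 2) * (1 + v x ^+ 2))).
Proof.
move=> lV Vq.
apply: (@riemann_unif_limit _ _ _ rbump2 (fun=> 1) v (fun x => u x - v x)) => //.
- exact: rbump2_cont.
- exact: rbump2_end_limits.
- by move=> th _; rewrite normr1.
- by move=> ? ?; rewrite subrr normr0.
move=> x; move: (u x) (v x) => t s.
have s0 := sqr1_gt0 s; have t0 := sqr1_gt0 t.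
pose tau th := s + th * (t - s).
(* This is the real part of [th / ((s - i) (tau th - i))], whose derivative in [th] is
   [1 / (tau th - i)^2] because [tau th - th * (t - s) = s]. *)
exists (fun th => (th * (s * tau th - 1)) * ((1 + s ^+ 2) * (1 + tau th * tau th))^-1).
split.
  rewrite /tau !mul0r subr0 !mul1r (addrC s) subrK -expr2.
  by field; rewrite !gt_eqF.
move=> th _; rewrite mul1r /rbump2 -/(tau th).
have ta0 : 1 + tau th * tau th != 0 by rewrite gt_eqF // -expr2 sqr1_gt0.
have dtau : is_derive th 1 tau (t - s).
  apply: is_derive_eq (derive1D (derive1_cst s th)
    (derive1M (derive1_id th) (derive1_cst (t - s) th))) _.
  by rewrite mulr0 addr0 add0r mul1r.
have dnum := derive1M (derive1_id th)
  (derive1B (derive1Z s dtau) (derive1_cst 1 th)).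
have dden := derive1Z (1 + s ^+ 2)
  (derive1D (derive1_cst 1 th) (derive1M dtau dtau)).
have den0 : (1 + s ^+ 2) * (1 + tau th * tau th) != 0.
  by rewrite mulf_neq0 // gt_eqF.
have dinv := @derive1V _ (fun y => (1 + s ^+ 2) * (1 + tau y * tau y)) _ _ den0 dden.
apply: is_derive_eq (derive1M dnum dinv) _.
have ta1 : 1 + tau th ^+ 2 != 0 by rewrite gt_eqF // sqr1_gt0.
have s1 : 1 + s ^+ 2 != 0 by rewrite gt_eqF.
move: ta0 ta1; rewrite /tau => ta0 ta1; field.
by rewrite ta1 s1.
Qed.

End RationalBump.

(** * Ramps, cutoffs and composition in uniform algebras *)

Section Ramp.
Context {R : realType}.

(** The truncation of [t] to [[0, 1]]; absolute values make its continuity immediate. *)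
Definition ramp (t : R) : R := (`|t| - `|t - 1| + 1) / 2.

Lemma ramp0 t : t <= 0 -> ramp t = 0.
Proof. by move=> t0; rewrite /ramp !ler0_norm; [field|lra|lra]. Qed.

Lemma ramp1 t : 1 <= t -> ramp t = 1.
Proof. by move=> t1; rewrite /ramp !ger0_norm; [field|lra|lra]. Qed.

Lemma ramp_id t : 0 <= t <= 1 -> ramp t = t.
Proof.
move=> /andP[t0 t1]; rewrite /ramp ger0_norm // ler0_norm; last by lra.
by field.
Qed.

Lemma ramp_itv t : 0 <= ramp t <= 1.
Proof.
have [t0|t0] := lerP t 0; first by rewrite ramp0 // lexx ler01.
have [t1|t1] := lerP 1 t; first by rewrite ramp1 // lexx ler01.
by rewrite ramp_id !ltW.
Qed.

Lemma ramp_homo : {homo ramp : s t / s <= t}.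
Proof.
move=> s t st.
have [t1|t1] := lerP 1 t; first by rewrite (ramp1 t1); case/andP: (ramp_itv s).
have [s0|s0] := lerP s 0; first by rewrite (ramp0 s0); case/andP: (ramp_itv t).
by rewrite !ramp_id //; apply/andP; split; lra.
Qed.

Lemma ramp_cont : continuous ramp.
Proof.
move=> x; apply: cvgM; last exact: cvg_cst.
apply: cvgD; last exact: cvg_cst.
apply: cvgB; first exact: norm_continuous.
apply: (continuous_comp (f := fun t : R => t - 1)); last exact: norm_continuous.
by apply: cvgB; [exact: cvg_id|exact: cvg_cst].
Qed.

Lemma ex_vanishing_extension (psi : R -> R) (M : R) : 0 < M ->
  continuous psi -> exists chi : R -> R,
  [/\ continuous chi, end_limits chi 0 0 & forall t, `|t| <= M -> chi t = psi t].
Proof.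
move=> M0 cpsi; pose chi t := psi t * ramp (M + 1 - `|t|).
have chi0 t : M + 1 <= `|t| -> chi t = 0.
  by move=> tM; rewrite /chi ramp0 ?mulr0 // subr_le0.
exists chi; split.
- move=> t; apply: cvgM; first exact: cpsi.
  apply: (continuous_comp (f := fun t : R => M + 1 - `|t|)); last exact: ramp_cont.
  by apply: cvgB; [exact: cvg_cst|exact: norm_continuous].
- move=> e e0; exists (M + 1); first exact: addr_gt0.
  move=> t; split=> ht; rewrite chi0 ?subrr ?normr0 ?(ltW e0) //.
    exact: le_trans ht (ler_norm t).
  by rewrite -normrN; apply: le_trans (ler_norm _); lra.
- by move=> t tM; rewrite /chi ramp1 ?mulr1 //; lra.
Qed.

End Ramp.

Section UnifAlgebraComposition.
Context {R : realType} {T : Type}.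
Variable B : set (T -> R).
Hypothesis aB : unif_algebra B.

Lemma unif_algebra_prod (I : Type) (r : seq I) (F : I -> T -> R) :
  (forall i, B (F i)) -> B (fun x => \prod_(i <- r) F i x).
Proof.
move=> BF; elim: r => [|i r IH].
  by apply: set_ext (unif_algebra_cst aB 1) _ => x; rewrite big_nil.
apply: set_ext (unif_algebra_mul aB (BF i) IH) _ => x.
by rewrite big_cons.
Qed.

(** Only the values of [psi] on the bounded range of [f] matter, so [psi] may be cut off to vanish
    at infinity. It is then a limit of combinations of [rbump (a * t + b)], and
    [rbump (a * f x + b)] is the inverse of an element of [B] that is at least [1]. *)
Lemma unif_algebra_comp (psi : R -> R) (f : T -> R) :
  continuous psi -> B f -> B (fun x => psi (f x)).
Proof.
move=> cpsi Bf; have [M M0 fM] := unif_algebra_bounded aB Bf.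
have lB := unif_algebra_lin aB.
have [chi [cchi lchi chiE]] := ex_vanishing_extension M0 cpsi.
have Hchi := dilates_dense rbump_cont rbump_end_limits rbump_nonconst cchi lchi.
apply: (@set_ext _ _ _ (fun x => chi (f x))); last by move=> x; exact: chiE.
apply: (unif_algebra_lim aB); apply: dilates_comp Hchi => // a b.
apply: sub_unif_limit.
have Bg : B (fun x => a * f x + b).
  by apply: lB.2 => //; exact: unif_algebra_cst.
have Bh : B (fun x => 1 + (a * f x + b) ^+ 2).
  apply: lin_spaceD => //; first exact: unif_algebra_cst.
  by apply: set_ext (unif_algebra_mul aB Bg Bg) _ => x; rewrite expr2.
apply: (unif_algebra_inv aB Bh ltr01) => x.
by rewrite lerDl sqr_ge0.
Qed.

End UnifAlgebraComposition.

(** * Functions vanishing at infinity in several variables *)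

Section VanishingFunctions.
Context {R : realType}.

Lemma rV_norm_le k (x : 'rV[R]_k) (c : R) : 0 <= c ->
  reflect (forall i, `|x 0 i| <= c) (`|x| <= c).
Proof.
move=> c0; apply: (iffP idP) => [xc i|H].
  by apply: le_trans xc; rewrite [leRHS]/Num.norm /= mx_normrE; apply/bigmax_geP; right;
    exists (0, i).
rewrite [leLHS]/Num.norm /= mx_normrE; apply/bigmax_leP; split => // -[i j] _ /=.
by rewrite (ord1 i).
Qed.

Lemma C0_unif_cont k (g : 'rV[R]_k -> R) : C0 g -> forall e : R, 0 < e ->
  exists2 d : R, 0 < d & forall x y, `|x - y| <= d -> `|g x - g y| <= e.
Proof.
move=> [cg g0] e e0; have e2 : 0 < e / 2 by rewrite divr_gt0.
have [M HM] := g0 _ e2.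
have cA : compact [set x : 'rV[R]_k | `|x| <= `|M| + 1].
  apply: bounded_closed_compact.
    exists (`|M| + 1); split; first exact: num_real.
    by move=> N MN x /= xM; apply: le_trans xM (ltW MN).
  by apply: (@closed_comp _ _ (fun x : 'rV[R]_k => `|x|) [set t | t <= `|M| + 1]);
    [move=> x _; exact: norm_continuous|exact: closed_le].
have [d d0 Hd] := compact_unif_cont cA cg e0.
exists (Num.min 1 (d / 2)); first by rewrite lt_min ltr01 divr_gt0.
move=> x y; rewrite le_min => /andP[xy1 xyd].
have [xM|xM] := lerP `|x| (`|M| + 1); first by apply: Hd => //; lra.
have Mx : M < `|x| by apply: le_lt_trans (ler_norm M) _; lra.
have My : M < `|y|.
  have := lerB_dist x y; move: (ler_norm M); lra.
apply: le_trans (ler_normB _ _) _; have := HM _ Mx; have := HM _ My; lra.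
Qed.

(** Tent functions in each coordinate multiply to a partition of unity on a cube, subordinate to a
    grid of mesh [d]. Weighting these products by the values of [g] at the grid points approximates
    [g], and each product lies in [B]. *)
Lemma C0_unif_algebra (T : Type) (B : set (T -> R)) k (y : 'I_k -> T -> R)
    (g : 'rV[R]_k -> R) : unif_algebra B ->
  (forall i h, continuous h -> end_limits h 0 0 -> B (fun x => h (y i x))) ->
  C0 g -> B (fun x => g (\row_i y i x)).
Proof.
move=> aB yB C0g; apply: (unif_algebra_lim aB) => e e0.
have e2 : 0 < e / 2 by rewrite divr_gt0.
have [d d0 gd] := C0_unif_cont C0g e2.
have [M0 HM0] := C0g.2 _ e2.
pose M := `|M0| + 1.
have M_gt0 : 0 < M by rewrite ltr_wpDl.
have HM x : M < `|x| -> `|g x| <= e / 2.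
  by move=> xM; apply/ltW/HM0; apply: le_lt_trans (ler_norm M0) _; rewrite /M in xM; lra.
(* The extra [d] completes the first ramp before [- M], and [m] is large enough for the last one to
   start after [M]; thus the tents sum to [1] on [[- M, M]]. *)
pose L := M + d.
pose m := (Num.truncn `|(M + L) / d|).+1.
have mL : (M + L) / d < m%:R by exact: truncn_bound.
move: m mL => m mL.
(* A difference of consecutive ramps is a tent; it rises on one mesh step and falls on the next, so
   its peak [t_ j] carries the index [j.+1]. *)
pose w j t := ramp ((t + L) / d - j%:R) - ramp ((t + L) / d - j.+1%:R).
pose t_ j : R := j.+1%:R * d - L.
have w_ge0 j t : 0 <= w j t.
  by rewrite subr_ge0; apply: ramp_homo; rewrite lerD2l lerN2 ler_nat.
have w_supp j t : w j t != 0 -> `|t - t_ j| <= d.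
  apply: contraNT; rewrite -ltNge ltr_normr => h; apply/eqP; rewrite /w.
  have E i : (t + L) / d - i%:R = (t - (i%:R * d - L)) / d by field; rewrite gt_eqF.
  have jS : j.+1%:R = j%:R + 1 :> R by rewrite -addn1 natrD.
  rewrite !E; move: h => /orP[] h; rewrite /t_ jS in h.
    rewrite !ramp1 ?subrr // ler_pdivlMr // mul1r ?jS; lra.
  rewrite !ramp0 ?subrr // pmulr_lle0 ?invr_gt0 // ?jS; lra.
have w_cont j : continuous (w j).
  have cr i : continuous (fun t => ramp ((t + L) / d - i)).
    move=> t; apply: (continuous_comp (f := fun t : R => (t + L) / d - i));
      last exact: ramp_cont.
    apply: cvgB; last exact: cvg_cst.
    apply: cvgM; last exact: cvg_cst.
    by apply: cvgD; [exact: cvg_id|exact: cvg_cst].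
  by move=> t; apply: cvgB; exact: cr.
have w_end j : end_limits (w j) 0 0.
  move=> e' e'0; exists (`|t_ j| + d + 1); first by rewrite ltr_wpDl // addr_ge0 // ltW.
  have far t : d < `|t - t_ j| -> `|w j t - 0| <= e'.
    move=> h; rewrite subr0; have [->|/w_supp] := eqVneq (w j t) 0.
      by rewrite normr0 ltW.
    by rewrite leNgt h.
  move=> t; split=> ht; apply: far; rewrite ltr_normr; apply/orP.
    by left; move: (ler_norm (t_ j)); lra.
  by right; move: (ler_norm (- t_ j)); rewrite normrN; lra.
pose s t := \sum_(j < m) w j t.
have sE t : s t = ramp ((t + L) / d) - ramp ((t + L) / d - m%:R).
  rewrite /s; elim: (m) => [|N IH]; first by rewrite big_ord0 mulr0n subr0 subrr.
  by rewrite big_ord_recr /= IH /w; ring.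
have s_itv t : 0 <= s t <= 1.
  rewrite sumr_ge0 //= sE.
  move: (ramp_itv ((t + L) / d)) (ramp_itv ((t + L) / d - m%:R)).
  by move=> /andP[? ?] /andP[? ?]; lra.
have s1 t : `|t| <= M -> s t = 1.
  rewrite ler_norml sE => /andP[t1 t2].
  rewrite ramp1 ?ramp0 ?subr0 //.
    rewrite subr_le0; apply: le_trans (ltW mL).
    by rewrite ler_pM2r ?invr_gt0 // lerD2r.
  by rewrite ler_pdivlMr // mul1r /L; lra.
pose tJ (J : {ffun 'I_k -> 'I_m}) : 'rV[R]_k := \row_i t_ (J i).
exists (fun x => \sum_(J : {ffun 'I_k -> 'I_m})
    g (tJ J) * \prod_(i < k) w (J i) (y i x)).
  have lB := unif_algebra_lin aB.
  apply: lin_space_sum => // J _.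
  have BP : B (fun x => \prod_(i < k) w (J i) (y i x)).
    by apply: unif_algebra_prod => // i; apply: yB.
  exact: (lin_spaceZ _ lB BP).
move=> x; set X := \row_i y i x.
have XE i : X 0 i = y i x by rewrite mxE.
pose P := \prod_(i < k) s (y i x).
(* Expanding the product of sums turns [P] into a sum over the grid points, indexed by the functions
   [J]. *)
have PE : P = \sum_(J : {ffun 'I_k -> 'I_m}) \prod_(i < k) w (J i) (y i x).
  by rewrite /P /s bigA_distr_bigA.
have P01 : 0 <= P <= 1.
  rewrite prodr_ile1 ?andbT; [|move=> i _]; rewrite ?prodr_ge0 // => i _.
  by case/andP: (s_itv (y i x)).
(* Inside the cube [P = 1]; outside it [g] is small and [P] stays between [0] and [1]. *)
have g1 : `|g X * (1 - P)| <= e / 2.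
  have [XM|XM] := lerP `|X| M.
    have -> : P = 1.
      move/(rV_norm_le _ (ltW M_gt0)): XM => XM.
      by apply: big1 => i _; apply: s1; rewrite -XE.
    by rewrite subrr mulr0 normr0 ltW.
  rewrite normrM -[leRHS]mulr1; apply: ler_pM => //; first exact: HM.
  by case/andP: P01 => ? ?; rewrite ger0_norm; lra.
have g2 : `|g X * P - \sum_(J : {ffun 'I_k -> 'I_m})
    g (tJ J) * \prod_(i < k) w (J i) (y i x)| <= e / 2.
  apply: (@le_trans _ _ (e / 2 * P)); last first.
    by case/andP: P01 => ? ?; rewrite ler_piMr // ltW.
  rewrite PE !mulr_sumr -sumrB; apply: le_trans (ler_norm_sum _ _ _) _.
  apply: ler_sum => J _; rewrite -mulrBl normrM.
  have Pw0 : 0 <= \prod_(i < k) w (J i) (y i x) by apply: prodr_ge0.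
  rewrite (ger0_norm Pw0).
  have [->|Pw] := eqVneq (\prod_(i < k) w (J i) (y i x)) 0; first by rewrite !mulr0.
  apply: ler_wpM2r => //; apply: gd; apply/(rV_norm_le _ (ltW d0)).
  move=> i; rewrite !mxE; apply: w_supp.
  by move/prodf_neq0: Pw => /(_ i isT).
have -> : g X = g X * (1 - P) + g X * P by ring.
rewrite -addrA; apply: le_trans (ler_normD _ _) _; lra.
Qed.

End VanishingFunctions.

(** * Neural spaces *)

Section NeuralSpaces.
Context {R : realType}.

Lemma cvg_end_limits (f : R -> R) (l r : R) :
  f x @[x --> -oo] --> l -> f x @[x --> +oo] --> r -> end_limits f l r.
Proof.
move=> /cvgrPdist_le fl /cvgrPdist_le fr e e0.
have [A [_ HA]] := fl _ e0; have [B [_ HB]] := fr _ e0.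
exists (`|A| + `|B| + 1); first by rewrite ltr_wpDl // addr_ge0.
move=> x; split=> xA; rewrite distrC.
  by apply: HB; move: (ler_norm B) (normr_ge0 A); lra.
by apply: HA; move: (ler_norm (- A)) (normr_ge0 B); rewrite normrN; lra.
Qed.

Lemma dotZl n k (a x : 'rV[R]_n) : dot (k *: a) x = k * dot a x.
Proof. by rewrite /dot mulr_sumr; apply: eq_bigr => i _; rewrite mxE mulrA. Qed.

Lemma dotZr n k (a x : 'rV[R]_n) : dot a (k *: x) = k * dot a x.
Proof. by rewrite /dot mulr_sumr; apply: eq_bigr => i _; rewrite mxE mulrCA. Qed.

Lemma dotDl n (a b x : 'rV[R]_n) : dot (a + b) x = dot a x + dot b x.
Proof. by rewrite /dot -big_split; apply: eq_bigr => i _; rewrite mxE mulrDl. Qed.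

Lemma dot_delta n (i : 'I_n) (x : 'rV[R]_n) : dot (delta_mx 0 i) x = x 0 i.
Proof.
rewrite /dot (bigD1 i) //= mxE !eqxx mul1r big1 ?addr0 // => j ji.
by rewrite mxE (negbTE ji) andbF mul0r.
Qed.

Lemma neural_space1_base n (phi : R -> R) (a : 'rV[R]_n) b :
  neural_space n phi 1 (fun x => phi (dot a x + b)).
Proof. by apply: sub_lspan; exists a, b. Qed.

Lemma neural_space1_ridge n (phi h : R -> R) (a : 'rV[R]_n) b :
  unif_limit (dilates phi) h ->
  unif_limit (neural_space n phi 1) (fun x => h (dot a x + b)).
Proof.
move=> Wh; apply: (@dilates_comp _ _ _ _ (fun x => dot a x + b)) Wh.
  exact: lspan_lin.
move=> c d; apply: sub_unif_limit.
apply: set_ext (neural_space1_base phi (c *: a) (c * b + d)) _ => x.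
by rewrite dotZl; congr phi; ring.
Qed.

Lemma neural_rbump_ridge n (h : R -> R) (a : 'rV[R]_n) b :
  continuous h -> end_limits h 0 0 ->
  unif_limit (neural_space n (@rbump R) 1) (fun x => h (dot a x + b)).
Proof.
move=> ch lh; apply: neural_space1_ridge.
exact: dilates_dense rbump_cont rbump_end_limits rbump_nonconst ch lh.
Qed.

(** By Feynman's formula the closure contains [(u v - 1) / ((1 + u^2) (1 + v^2))] for affine [u] and
    [v]; this yields the products of two generators. *)
Lemma neural_rbump_algebra n :
  unif_algebra (unif_limit (neural_space n (@rbump R) 1)).
Proof.
apply: lspan_unif_algebra.
- move=> _ [a [b ->]]; exists 1 => // x.
  rewrite ger0_norm ?invr_ge0 ?(ltW (sqr1_gt0 _)) //.
  by rewrite /rbump invf_le1 ?sqr1_gt0 // lerDl sqr_ge0.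
- move=> k; apply: set_ext (neural_space1_ridge 0 0 (dilates_cst rbump_nonconst k)) _.
  by [].
- move=> _ _ [a [b ->]] [a' [b' ->]].
  have lV := unif_limit_lin (@lspan_lin _ _ [set h : 'rV[R]_n -> R |
    exists (a : 'rV[R]_n) (b : R), h = (fun x => rbump (dot a x + b))]).
  have H u v be be' : unif_limit (neural_space n (@rbump R) 1)
      (fun x => ((dot u x + be) * (dot v x + be') - 1) /
        ((1 + (dot u x + be) ^+ 2) * (1 + (dot v x + be') ^+ 2))).
    apply: (@feynman_unif_limit _ _ _ (fun x => dot u x + be) (fun x => dot v x + be')).
      exact: lspan_lin.
    move=> th; apply: set_ext (neural_rbump_ridge (v + th *: (u + (-1) *: v))
      (be' + th * (be - be')) rbump2_cont rbump2_end_limits) _ => x.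
    by rewrite !dotDl !dotZl !dotDl !dotZl; congr rbump2; ring.
  (* Changing the sign of [v] turns the numerator [u v - 1] into [- u v - 1]. The sum of the two is
     [- 2], so half of it with opposite sign leaves the product of the two bumps. *)
  apply: set_ext (lin_spaceZ (- 2^-1) lV
    (lin_spaceD lV (H a a' b b') (H a ((-1) *: a') b (- b')))) _ => x /=.
  rewrite dotZl /rbump; move: (dot a x + b) (dot a' x) => s t.
  have -> : -1 * t + - b' = - (t + b') by ring.
  move: (t + b') => {}t; rewrite sqrrN.
  field; by rewrite !gt_eqF ?sqr1_gt0.
Qed.

(** A uniform algebra is stable under composition with [phi], so the inclusion propagates from the
    first layer to all deeper ones. *)
Lemma neural_space_sub_algebra n (phi : R -> R) (B : set ('rV[R]_n -> R)) :
  unif_algebra B -> continuous phi ->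
  (forall a b, B (fun x => phi (dot a x + b))) ->
  neural_space_infty n phi `<=` B.
Proof.
move=> aB cphi B1 f [[//|l] _]; have lB := unif_algebra_lin aB.
elim: l f => [|l IH] f; first by apply: lspan_sub => // _ [a [b ->]].
apply: lspan_sub => // _ [g [b [/IH Bg ->]]].
apply: (unif_algebra_comp aB (psi := phi) (f := fun x => g x + b)) => //.
by apply: lin_spaceD => //; exact: unif_algebra_cst.
Qed.

Lemma neural_space_sub_infty n (phi : R -> R) l : (0 < l)%N ->
  neural_space n phi l `<=` neural_space_infty n phi.
Proof. by move=> l0 f fl; exists l. Qed.

Lemma unif_limitS (T : Type) (V W : set (T -> R)) :
  V `<=` W -> unif_limit V `<=` unif_limit W.
Proof.
by move=> VW; apply: unif_limit_sub => f /VW; exact: sub_unif_limit.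
Qed.

Lemma C0_ridge_sub n :
  C0_ridge R n `<=` unif_limit (neural_space n (@rbump R) 1).
Proof.
move=> _ [k [P [g [C0g ->]]]].
pose y i (x : 'rV[R]_n) := P x 0 i.
apply: (@set_ext _ _ _ (fun x => g (\row_i y i x))); last first.
  by move=> x; congr g; apply/rowP => i; rewrite mxE.
apply: (C0_unif_algebra (neural_rbump_algebra n)) C0g => i h ch lh.
(* The vector representing the linear form that is the [i]-th coordinate of [P]. *)
pose a : 'rV[R]_n := \row_j P (delta_mx 0 j) 0 i.
apply: set_ext (neural_rbump_ridge a 0 ch lh) _ => x; congr h.
rewrite addr0 /y {2}[x]row_sum_delta linear_sum summxE /dot.
by apply: eq_bigr => j _; rewrite linearZ !mxE mulrC.
Qed.

Lemma rbump_C0_ridge n (a : 'rV[R]_n) b :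
  C0_ridge R n (fun x => rbump (dot a x + b)).
Proof.
exists 1%N, (mulmxr a^T), (fun z => rbump (z 0 0 + b)); split; last first.
  apply/funext => x; congr rbump; congr (_ + b); rewrite mxE /dot.
  by apply: eq_bigr => i _; rewrite mxE mulrC.
split.
  have cb : continuous (fun t : R => rbump (t + b)).
    move=> t; apply: (continuous_comp (f := fun t : R => t + b));
      last exact: rbump_cont.
    by apply: cvgD; [exact: cvg_id|exact: cvg_cst].
  move=> z; exact: (@continuous_comp _ _ _ (fun z : 'rV[R]_1 => z 0 0)
    (fun t => rbump (t + b)) z (@coord_continuous R 1 1 0 0 z) (cb _)).
move=> e e0; have e2 : 0 < e / 2 by rewrite divr_gt0.
have [A A0 HA] := rbump_end_limits e2.
exists (A + `|b|) => z zM.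
apply: (@le_lt_trans _ _ (e / 2)); last by lra.
have z0 : A + `|b| < `|z 0 0|.
  rewrite ltNge; apply/negP => h; move: zM; rewrite ltNge => /negP; apply.
  have Ab : 0 <= A + `|b| by rewrite addr_ge0 // ltW.
  by apply/(rV_norm_le _ Ab) => i; rewrite (ord1 i).
rewrite -[rbump _]subr0; move: z0; rewrite ltr_normr => /orP[] z0.
  by apply: (HA _).1; move: (ler_norm (- b)); rewrite normrN; lra.
by apply: (HA _).2; move: (ler_norm b); lra.
Qed.

(** Every closure in the statement is identified with that of the first layer for [rbump], which is
    an algebra. *)
Lemma equal_limits_closures n (phi : R -> R) c : continuous phi ->
  end_limits phi c c -> ~ (exists k : R, forall x : R, phi x = k) ->
  unif_limit (neural_space n phi 1) = unif_limit (neural_space_infty n phi) /\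
  unif_limit (neural_space_infty n phi) = unif_limit (lspan (C0_ridge R n)).
Proof.
move=> cphi lphi nphi.
have aU := neural_rbump_algebra n.
have lU := unif_algebra_lin aU.
have rU : neural_space n (@rbump R) 1 `<=` unif_limit (neural_space n phi 1).
  apply: lspan_sub; first by apply: unif_limit_lin; exact: lspan_lin.
  move=> _ [a [b ->]]; apply: neural_space1_ridge.
  exact: dilates_dense cphi lphi nphi rbump_cont rbump_end_limits.
have pU : neural_space_infty n phi `<=` unif_limit (neural_space n (@rbump R) 1).
  apply: neural_space_sub_algebra => // a b; apply: neural_space1_ridge.
  exact: dilates_dense_cst rbump_cont rbump_end_limits rbump_nonconst cphi lphi.
have r8 : neural_space n (@rbump R) 1 `<=` unif_limit (neural_space_infty n phi).
  by move=> f /rU; apply: unif_limitS; exact: neural_space_sub_infty.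
have E8 : unif_limit (neural_space_infty n phi) =
  unif_limit (neural_space n (@rbump R) 1) by exact: unif_limit_eq.
rewrite E8; split; apply: unif_limit_eq => //.
- by move=> f /(neural_space_sub_infty (ltn0Sn 0)) /pU.
- by apply: lspan_sub;
    [apply: unif_limit_lin; exact: lspan_lin|
     move=> _ [a [b ->]]; apply: sub_unif_limit; apply: sub_lspan;
     exact: rbump_C0_ridge].
- by apply: lspan_sub => //; exact: C0_ridge_sub.
Qed.

End NeuralSpaces.

(** * The hyperbolic tangent and sigmoids *)

Section HyperbolicTangent.
Context {R : realType}.
Implicit Types x y t : R.

Lemma expRpN_gt0 x : 0 < expR x + expR (- x).
Proof. by rewrite addr_gt0 ?expR_gt0. Qed.

Lemma tanh_lt1 x : `|tanh x| < 1.
Proof.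
rewrite /tanh normrM normfV (gtr0_norm (expRpN_gt0 x)).
rewrite ltr_pdivrMr ?expRpN_gt0 // mul1r ltr_norml.
by move: (expR_gt0 x) (expR_gt0 (- x)) => ? ?; apply/andP; split; lra.
Qed.

Lemma tanhN x : tanh (- x) = - tanh x.
Proof.
by rewrite /tanh opprK -mulNr opprB [expR (- x) + expR x]addrC.
Qed.

Lemma tanhD x y : tanh (x + y) = (tanh x + tanh y) * (1 + tanh y * tanh x)^-1.
Proof.
rewrite /tanh !opprD !expRD !expRN.
have ex := expR_gt0 x; have ey := expR_gt0 y.
move: (expR x) (expR y) ex ey => a b a0 b0.
have h1 : a * a + 1 != 0 by rewrite gt_eqF // addr_gt0 // mulr_gt0.
have h2 : b * b + 1 != 0 by rewrite gt_eqF // addr_gt0 // mulr_gt0.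
have h3 : a * a * (b * b) + 1 != 0 by rewrite gt_eqF // addr_gt0 // !mulr_gt0.
have a1 : a != 0 by rewrite gt_eqF.
have b1 : b != 0 by rewrite gt_eqF.
have E1 : (a - a^-1) / (a + a^-1) = (a * a - 1) / (a * a + 1) by field; rewrite a1 h1.
have E2 : (b - b^-1) / (b + b^-1) = (b * b - 1) / (b * b + 1) by field; rewrite b1 h2.
rewrite E1 E2.
have -> : (a * b - a^-1 * b^-1) / (a * b + a^-1 * b^-1) =
  (a * a * (b * b) - 1) / (a * a * (b * b) + 1) by field; rewrite a1 b1 h3.
have -> : 1 + (b * b - 1) / (b * b + 1) * ((a * a - 1) / (a * a + 1)) =
  2 * (a * a * (b * b) + 1) / ((a * a + 1) * (b * b + 1)) by field; rewrite h2 h1.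
by field; rewrite h2 h1 h3.
Qed.

Lemma tanh_cont : continuous (@tanh R).
Proof.
have cN : continuous (fun t : R => expR (- t)).
  move=> t; apply: (continuous_comp (f := fun t : R => - t)); last exact: continuous_expR.
  by apply: cvgN; exact: cvg_id.
move=> x; apply: cvgM; first by apply: cvgB; [exact: continuous_expR|exact: cN].
apply: cvgV; first by rewrite gt_eqF // expRpN_gt0.
by apply: cvgD; [exact: continuous_expR|exact: cN].
Qed.

Lemma tanh_end_limits : end_limits (@tanh R) (-1) 1.
Proof.
move=> e e0; exists (2 / e); first by rewrite divr_gt0.
have key y : 2 / e <= y -> `|tanh y - 1| <= e.
  move=> ey; have E := expRpN_gt0 y.
  have -> : tanh y - 1 = - (2 * expR (- y) / (expR y + expR (- y))).
    by rewrite /tanh; field; rewrite gt_eqF.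
  have N0 := expR_gt0 (- y).
  rewrite normrN ger0_norm; last by rewrite divr_ge0 ?mulr_ge0 // ltW.
  have y0 : 0 < 2 / e by rewrite divr_gt0.
  rewrite ler_pdivrMr //.
  have N1 : expR (- y) <= 1 by rewrite expR_le1; lra.
  have E2 : 2 / e <= expR y by have := expR_ge1Dx y; lra.
  have : 2 <= e * expR y by rewrite mulrC -ler_pdivrMr.
  have : 0 <= e * expR (- y) by rewrite mulr_ge0 // ltW.
  by lra.
move=> x; split; first exact: key.
rewrite lerNr => /key; rewrite tanhN => h.
by rewrite -normrN opprD opprK.
Qed.

Lemma end_limits_comp (f psi : R -> R) l r :
  end_limits f l r -> {for l, continuous psi} -> {for r, continuous psi} ->
  end_limits (fun x => psi (f x)) (psi l) (psi r).
Proof.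
move=> lf cl cr e e0.
have near z : {for z, continuous psi} -> exists2 d : R, 0 < d &
    forall y, `|y - z| <= d -> `|psi y - psi z| <= e.
  move=> /cvgrPdist_le /(_ _ e0); rewrite -nbhs_ballE => -[d /= d0 dP].
  exists (d / 2); first by rewrite divr_gt0.
  move=> y yz; rewrite distrC; apply: dP; rewrite -ball_normE /= distrC.
  by apply: le_lt_trans yz _; lra.
have [d d0 Hd] := near _ cl; have [d' d'0 Hd'] := near _ cr.
have [A A0 HA] := lf _ d0; have [B B0 HB] := lf _ d'0.
exists (A + B); first exact: addr_gt0.
move=> x; split=> hx; first by apply: Hd'; apply: (HB x).1; lra.
by apply: Hd; apply: (HA x).2; lra.
Qed.

(** The shift by [2] keeps the argument of [ln] positive, also at the two limits of [tanh], so that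
    this is a continuous function with finite limits. *)
Definition ln_tanh (t : R) : R := ln (2 + tanh t).

Lemma tanhp2_gt0 t : 0 < 2 + tanh t.
Proof. by have := tanh_lt1 t; rewrite ltr_norml => /andP[? ?]; lra. Qed.

Lemma ln_add2_cont z : -2 < z -> {for z, continuous (fun y : R => ln (2 + y))}.
Proof.
move=> z2.
have c1 : {for z, continuous (fun y : R => 2 + y)}.
  by apply: cvgD; [exact: cvg_cst|exact: cvg_id].
have c2 : {for 2 + z, continuous (@ln R)} by apply: continuous_ln; lra.
exact: (continuous_comp c1 c2).
Qed.

Lemma ln_tanh_cont : continuous ln_tanh.
Proof.
move=> t; have c2 : {for tanh t, continuous (fun y : R => ln (2 + y))}.
  by apply: ln_add2_cont; have := tanhp2_gt0 t; lra.
exact: (continuous_comp (@tanh_cont t) c2).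
Qed.

Lemma ln_tanh_end_limits : exists l r, end_limits ln_tanh l r.
Proof.
exists (ln (2 + -1)), (ln (2 + 1)).
have cN : {for (-1 : R), continuous (fun y : R => ln (2 + y))}.
  by apply: ln_add2_cont; lra.
have c1 : {for (1 : R), continuous (fun y : R => ln (2 + y))}.
  by apply: ln_add2_cont; lra.
exact: end_limits_comp tanh_end_limits cN c1.
Qed.

Lemma expR_ln_tanh t : expR (ln_tanh t) = 2 + tanh t.
Proof. by rewrite /ln_tanh lnK // posrE tanhp2_gt0. Qed.

End HyperbolicTangent.

Section Sigmoids.
Context {R : realType}.

Lemma end_limits_rescale (f : R -> R) l r : l != r -> end_limits f l r ->
  end_limits (fun x => (f x - l) / (r - l)) 0 1.
Proof.
move=> lr lf; have rl : r - l != 0 by rewrite subr_eq0 eq_sym.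
have c z : {for z, continuous (fun y => (y - l) / (r - l))}.
  by apply: cvgM; [apply: cvgB; [exact: cvg_id|exact: cvg_cst]|exact: cvg_cst].
by have := end_limits_comp lf (c l) (c r); rewrite subrr mul0r divff.
Qed.

(** Rescaling [f] gives limits [0] and [1] whichever of [l] and [r] is larger. The inner function
    [u] is arbitrary, so that it can be an affine form or an element of the first layer. *)
Lemma sigmoid_dense (T : Type) (V : set (T -> R)) (f g : R -> R) (u : T -> R)
    l r l' r' : lin_space V -> (forall k, unif_limit V (fun=> k)) ->
  continuous f -> end_limits f l r -> l != r ->
  (forall a b, unif_limit V (fun x => f (a * u x + b))) ->
  continuous g -> end_limits g l' r' -> unif_limit V (fun x => g (u x)).
Proof.
move=> lV cV cf lf lr Vf cg lg.
have lU := unif_limit_lin lV.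
pose s x := (f x - l) / (r - l).
have cs : continuous s.
  by move=> x; apply: cvgM; [apply: cvgB; [exact: cf|exact: cvg_cst]|exact: cvg_cst].
have ls : end_limits s 0 1 by exact: end_limits_rescale.
apply: unif_limitK => e e0.
have [m [a [t [d [_ gd]]]]] := sigmoid_approx cs ls cg lg e0.
exists (fun x => l' + \sum_(i < m) d i * s (a * (u x - t i))); last by move=> x.
have HV i : unif_limit V (fun x => d i * s (a * (u x - t i))); last first.
  exact: (lin_spaceD lU (cV l') (lin_space_sum _ lU (fun i _ => HV _))).
have H := lin_spaceB lU (Vf a (- (a * t i))) (cV l).
apply: set_ext (lin_spaceZ (d i / (r - l)) lU H) _ => x.
have -> : a * (u x - t i) = a * u x + - (a * t i) by ring.
by rewrite /s [RHS]mulrA mulrAC.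
Qed.

End Sigmoids.

(** * Activation functions with distinct limits *)

Section DistinctLimits.
Context {R : realType} {n : nat}.

Lemma tanh_products_algebra : unif_algebra (unif_limit (lspan (tanh_products R n))).
Proof.
apply: lspan_unif_algebra.
- move=> _ [m [a ->]]; exists 1 => // x; rewrite normr_prod.
  by apply: prodr_ile1 => i _; rewrite normr_ge0 /= ltW // tanh_lt1.
- move=> k; apply: sub_unif_limit.
  have P0 : tanh_products R n (fun x => \prod_(j < 0) tanh (dot ((fun=> 0) j) x)).
    by exists 0%N, (fun=> 0).
  apply: set_ext (lin_spaceZ k (@lspan_lin _ _ _) (sub_lspan P0)) _ => x.
  by rewrite big_ord0 mulr1.
- move=> _ _ [m [a ->]] [m' [a' ->]]; apply: sub_unif_limit; apply: sub_lspan.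
  exists (m + m')%N.
  exists (fun i => match fintype.split i with inl j => a j | inr j => a' j end).
  apply/funext => x; rewrite big_split_ord /=; congr (_ * _); apply: eq_bigr => i _.
    by rewrite (unsplitK (inl i)).
  by rewrite (unsplitK (inr i)).
Qed.

(** The addition formula writes a shifted [tanh] as a quotient whose denominator is at least
    [1 - |tanh b| > 0], hence invertible in the algebra. *)
Lemma tanh_products_dot (a : 'rV[R]_n) b :
  unif_limit (lspan (tanh_products R n)) (fun x => tanh (dot a x + b)).
Proof.
have aB := tanh_products_algebra; have lB := unif_algebra_lin aB.
have B1 : unif_limit (lspan (tanh_products R n)) (fun x => tanh (dot a x)).
  apply: sub_unif_limit; apply: sub_lspan; exists 1%N, (fun=> a).
  by apply/funext => x; rewrite big_ord1.
have Bn := lin_spaceD lB B1 (unif_algebra_cst aB (tanh b)).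
have Bd := lin_spaceD lB (unif_algebra_cst aB 1) (lin_spaceZ (tanh b) lB B1).
have d0 : 0 < 1 - `|tanh b| by rewrite subr_gt0 tanh_lt1.
have dl x : 1 - `|tanh b| <= 1 + tanh b * tanh (dot a x).
  rewrite lerD2l lerNl; apply: le_trans (ler_norm _) _.
  by rewrite normrN normrM ler_piMr // ltW // tanh_lt1.
apply: set_ext (unif_algebra_mul aB Bn (unif_algebra_inv aB Bd d0 dl)) _ => x.
by rewrite tanhD.
Qed.

Variables (phi : R -> R) (phi_m phi_p : R).
Hypothesis phi_cont : continuous phi.
Hypothesis phi_lim : end_limits phi phi_m phi_p.
Hypothesis phi_neq : phi_m != phi_p.

Let phi_nonconst : ~ exists k : R, forall x : R, phi x = k.
Proof.
move=> [k H]; move/eqP: phi_neq; apply.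
have key z : (forall e : R, 0 < e -> `|k - z| <= e) -> z = k.
  move=> h; apply/eqP; rewrite eq_sym -subr_eq0 -normr_le0.
  by apply/ler_addgt0Pl => e e0; rewrite addr0; exact: h.
have -> : phi_m = k.
  by apply: key => e /phi_lim[A A0 HA]; rewrite -(H (- A)); exact: (HA _).2.
by apply/esym/key => e /phi_lim[A A0 HA]; rewrite -(H A); exact: (HA _).1.
Qed.

Lemma neural_infty_sub_tanh :
  neural_space_infty n phi `<=` unif_limit (lspan (tanh_products R n)).
Proof.
have aB := tanh_products_algebra.
apply: neural_space_sub_algebra => // a b.
apply: (@sigmoid_dense _ _ _ (@tanh R) phi (fun x => dot a x + b)
  (-1) 1 phi_m phi_p) => //.
- exact: lspan_lin.
- exact: unif_algebra_cst.
- exact: tanh_cont.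
- exact: tanh_end_limits.
- by rewrite lt_eqF //; lra.
- move=> c d; apply: set_ext (tanh_products_dot (c *: a) (c * b + d)) _ => x.
  by rewrite dotZl; congr tanh; ring.
Qed.

Let U1 := unif_limit (neural_space n phi 1).
Let U2 := unif_limit (neural_space n phi 2).

Let U1_lin : lin_space U1.
Proof. by apply: unif_limit_lin; exact: lspan_lin. Qed.

Let U2_lin : lin_space U2.
Proof. by apply: unif_limit_lin; exact: lspan_lin. Qed.

Let U1_cst k : U1 (fun=> k).
Proof.
apply: set_ext (neural_space1_ridge 0 0 (dilates_cst phi_nonconst k)) _; by [].
Qed.

Let U2_base f b : neural_space n phi 1 f -> U2 (fun x => phi (f x + b)).
Proof. by move=> Nf; apply: sub_unif_limit; apply: sub_lspan; exists f, b. Qed.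

Let U2_cst k : U2 (fun=> k).
Proof.
apply: (@dilates_comp _ _ (neural_space n phi 2) phi (fun=> 0) _ _ (fun=> k)).
- exact: lspan_lin.
- move=> a b; apply: set_ext (U2_base b (lspan_lin _).1) _ => x.
  by rewrite mulr0.
- exact: dilates_cst.
Qed.

Let U1_ridge (g : R -> R) l r a : continuous g -> end_limits g l r ->
  U1 (fun x => g (dot a x)).
Proof.
move=> cg lg; apply: (@sigmoid_dense _ _ _ phi g (dot a) phi_m phi_p l r) => //.
  exact: lspan_lin.
move=> c d; apply: sub_unif_limit.
by apply: set_ext (neural_space1_base phi (c *: a) d) _ => x; rewrite dotZl.
Qed.

Let U1_bounded f : U1 f -> bounded_fct f.
Proof.
apply: bounded_unif_limit; apply: lspan_sub; first exact: bounded_lin.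
move=> _ [a [b ->]]; have [C C0 phiC] := end_limits_bounded phi_cont phi_lim.
by exists C.
Qed.

(** After a cutoff [psi] is uniformly continuous, so [f] may be replaced by a nearby [g] in the
    first layer itself. For such [g] the functions [phi (a * g x + b)] belong to the second layer
    and approximate the cut-off [psi] at [g x]. *)
Let U2_comp (psi : R -> R) f : continuous psi -> U1 f -> U2 (fun x => psi (f x)).
Proof.
move=> cpsi U1f; have [M M0 fM] := U1_bounded U1f.
have [chi [cchi lchi chiE]] := ex_vanishing_extension M0 cpsi.
apply: (@set_ext _ _ _ (fun x => chi (f x))); last by move=> x; exact: chiE.
apply: unif_limitK => e e0.
have [d d0 chid] := end_limits_unif_cont cchi lchi e0.
have [g Ng fg] := U1f _ d0.
exists (fun x => chi (g x)); last by move=> x; exact: chid.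
apply: (@sigmoid_dense _ _ _ phi chi g phi_m phi_p 0 0) => //.
  exact: lspan_lin.
move=> a b; apply: (U2_base (f := fun x => a * g x)).
exact: (lin_spaceZ _ (@lspan_lin _ _ _) Ng).
Qed.

(* [tanh = exp \o ln_tanh - 2] with [ln_tanh (dot a x)] in the closure of the
   first layer, and a product of exponentials is the exponential of a sum. *)
Let U2_exp_prod (s : seq 'rV[R]_n) f : U1 f ->
  U2 (fun x => expR (f x) * \prod_(a <- s) tanh (dot a x)).
Proof.
elim: s f => [|a s IH] f U1f.
  apply: set_ext (U2_comp (@continuous_expR R) U1f) _ => x.
  by rewrite big_nil mulr1.
have [l [r lt]] := @ln_tanh_end_limits R.
have U1a := U1_ridge a (@ln_tanh_cont R) lt.
apply: set_ext (lin_spaceB U2_lin (IH _ (lin_spaceD U1_lin U1f U1a))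
  (lin_spaceZ 2 U2_lin (IH _ U1f))) _ => x.
by rewrite expRD expR_ln_tanh big_cons; ring.
Qed.

Lemma tanh_products_sub : tanh_products R n `<=` U2.
Proof.
move=> _ [m [a ->]].
apply: set_ext (U2_exp_prod [seq a j | j <- index_enum 'I_m] (U1_cst 0)) _ => x.
by rewrite expR0 mul1r big_map.
Qed.

Lemma distinct_limits_closures :
  unif_limit (neural_space n phi 2) = unif_limit (neural_space_infty n phi) /\
  unif_limit (neural_space_infty n phi) = unif_limit (lspan (tanh_products R n)).
Proof.
have tU : lspan (tanh_products R n) `<=` U2.
  exact: lspan_sub U2_lin tanh_products_sub.
have U28 : U2 `<=` unif_limit (neural_space_infty n phi).
  by apply: unif_limitS; exact: neural_space_sub_infty.
have E8 : unif_limit (neural_space_infty n phi) =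
    unif_limit (lspan (tanh_products R n)).
  apply: unif_limit_eq; first exact: neural_infty_sub_tanh.
  by move=> f /tU /U28.
split => //; rewrite E8; apply: unif_limit_eq; last exact: tU.
by move=> f /(neural_space_sub_infty (ltn0Sn 1)) /neural_infty_sub_tanh.
Qed.

End DistinctLimits.

(** * Separation of the first two layers in dimension at least two *)

Section Separation.
Context {R : realType} {n : nat}.
Variables (i0 i1 : 'I_n).
Hypothesis i01 : i0 != i1.

Let v (s : R) : 'rV[R]_n := delta_mx 0 i0 + s *: delta_mx 0 i1.

Let dot_v a s t : dot a (t *: v s) = t * (a 0 i0 + s * a 0 i1).
Proof.
rewrite dotZr; congr (_ * _).
have -> : dot a (v s) = dot (v s) a by apply: eq_bigr => i _; exact: mulrC.
by rewrite dotDl dotZl !dot_delta.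
Qed.

(* A ridge function has limits in the directions [v s] and [- v s] whose sum
   does not depend on [s], apart from finitely many [s]. *)
Lemma neural_space1_antipodal (phi : R -> R) l r : end_limits phi l r ->
  forall f, neural_space n phi 1 f -> exists kappa s0 : R, forall s, s0 <= `|s| ->
    forall e : R, 0 < e -> exists A : R, forall t, A <= t ->
      `|f (t *: v s) + f (- t *: v s) - kappa| <= e.
Proof.
move=> lphi; apply: lspan_sub.
  split.
    by exists 0, 0 => s _ e e0; exists 0 => t _; rewrite addr0 subrr normr0 ltW.
  move=> c f g [k [s0 Hf]] [k' [s0' Hg]]; exists (c * k + k'), (`|s0| + `|s0'|).
  move=> s hs e e0.
  have c0 : 0 < 1 + `|c| by rewrite ltr_wpDr.
  pose d := e / (1 + `|c|); have d0 : 0 < d by rewrite divr_gt0.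
  have sf : s0 <= `|s| by move: (ler_norm s0) (normr_ge0 s0'); lra.
  have sg : s0' <= `|s| by move: (ler_norm s0') (normr_ge0 s0); lra.
  have [A HA] := Hf _ sf _ d0; have [A' HA'] := Hg _ sg _ d0.
  exists (`|A| + `|A'|) => t ht.
  have tA : A <= t by move: (ler_norm A) (normr_ge0 A'); lra.
  have tA' : A' <= t by move: (ler_norm A') (normr_ge0 A); lra.
  have -> : c * f (t *: v s) + g (t *: v s) +
      (c * f (- t *: v s) + g (- t *: v s)) - (c * k + k') = c * (f (t *: v s) + f (- t *: v s) - k) +
      (g (t *: v s) + g (- t *: v s) - k') by ring.
  apply: le_trans (ler_normD _ _) _; rewrite normrM.
  have -> : e = `|c| * d + d by rewrite /d; field; rewrite gt_eqF.
  by apply: lerD; [apply: ler_wpM2l => //; exact: HA|exact: HA'].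
move=> _ [a [b ->]]; set p := a 0 i0; set q := a 0 i1.
have [/andP[/eqP p0 /eqP q0]|pq] := boolP ((p == 0) && (q == 0)).
  exists (phi b + phi b), 0 => s _ e e0; exists 0 => t _.
  by rewrite !dot_v -/p -/q p0 q0 mulr0 addr0 !mulr0 add0r subrr normr0 ltW.
(* This bound excludes [s = - p / q], the only parameter for which [v s] is orthogonal to [a]. If
   [q = 0] the quotient is [0] by convention, and [p] is nonzero. *)
exists (l + r), (`|p / q| + 1) => s hs e e0.
have w0 : p + s * q != 0.
  have [q0|q0] := eqVneq q 0.
    by move: pq; rewrite q0 eqxx andbT mulr0 addr0.
  apply/eqP => H; have E : p = - s * q by rewrite -[p](addrK (s * q)) H; ring.
  by move: hs; rewrite E mulfK // normrN; lra.
have e2 : 0 < e / 2 by rewrite divr_gt0.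
have [A A0 HA] := lphi _ e2.
have nw : 0 < `|p + s * q| by rewrite normr_gt0.
exists ((A + `|b|) / `|p + s * q|) => t.
rewrite ler_pdivrMr // !dot_v -/p -/q; move: (p + s * q) w0 nw => w w0 nw ht.
have b1 := ler_norm b; have b2 : - b <= `|b| by rewrite -normrN ler_norm.
have tri x y : `|x - l| <= e / 2 -> `|y - r| <= e / 2 -> `|x + y - (l + r)| <= e.
  rewrite !ler_norml => /andP[? ?] /andP[? ?]; apply/andP; split; lra.
have [wp|wn] := ltrP 0 w.
  rewrite (gtr0_norm wp) in ht; rewrite [X in X - (l + r)]addrC; apply: tri.
    by apply: (HA _).2; rewrite mulNr; lra.
  by apply: (HA _).1; lra.
rewrite (ler0_norm wn) in ht; apply: tri.
  by apply: (HA _).2; lra.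
by apply: (HA _).1; rewrite mulNr; lra.
Qed.

(** Along [v s] and [v (- s)] the antipodal sums of the product are [2 * X] and [- 2 * X] with
    [X >= 9 / 16] for large [t]. An [f] within [1 / 8] of the product, whose two antipodal sums lie
    within [1 / 8] of the same [k], would force [4 * X <= 6 / 8]. *)
Lemma tanh_product_notin (phi : R -> R) l r : end_limits phi l r ->
  ~ unif_limit (neural_space n phi 1)
      (fun x => tanh (dot (delta_mx 0 i0) x) * tanh (dot (delta_mx 0 i1) x)).
Proof.
move=> lphi; set F := fun x => _.
have e8 : 0 < 1 / 8 :> R by lra.
have e4 : 0 < 1 / 4 :> R by lra.
move=> /(_ _ e8) [f Nf Ff].
have [k [s0 Hk]] := neural_space1_antipodal lphi Nf.
pose s := `|s0| + 1; have s1 : 1 <= s by rewrite lerDr.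
have hs : s0 <= `|s|.
  by rewrite ger0_norm; [rewrite /s; move: (ler_norm s0); lra|lra].
have hsN : s0 <= `|- s| by rewrite normrN.
have [A HA] := Hk _ hs _ e8; have [B HB] := Hk _ hsN _ e8.
have [T T0 HT] := @tanh_end_limits R _ e4.
pose t := `|A| + `|B| + T.
have tA : A <= t by rewrite /t; move: (ler_norm A) (normr_ge0 B); lra.
have tB : B <= t by rewrite /t; move: (ler_norm B) (normr_ge0 A); lra.
have tT : T <= t by rewrite /t; move: (normr_ge0 B) (normr_ge0 A); lra.
have FE u z : F (z *: v u) = tanh z * tanh (z * u).
  rewrite /F !dot_delta !mxE !eqxx (negbTE i01) eq_sym (negbTE i01) /=.
  by rewrite mulr0 mulr1 addr0 add0r mulr1.
have x34 z : T <= z -> 3 / 4 <= tanh z.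
  by move=> /((HT z).1); rewrite ler_norml => /andP[? ?]; lra.
have t0 : 0 <= t by lra.
have ts : T <= t * s by apply: (le_trans tT); rewrite ler_peMr.
have X916 : 9 / 16 <= tanh t * tanh (t * s).
  have -> : 9 / 16 = 3 / 4 * (3 / 4) :> R by field.
  by apply: ler_pM (x34 _ tT) (x34 _ ts); lra.
move: (HA _ tA) (HB _ tB) (Ff (t *: v s)) (Ff (- t *: v s))
  (Ff (t *: v (- s))) (Ff (- t *: v (- s))).
rewrite !FE !mulNr mulrN opprK !tanhN.
move: X916; move: (tanh t) (tanh (t * s)) => x y.
rewrite !mulrN !mulNr opprK; move: (x * y) => X ?.
rewrite !ler_norml => /andP[? ?] /andP[? ?] /andP[? ?] /andP[? ?] /andP[? ?] /andP[? ?].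
by lra.
Qed.

End Separation.

Theorem theorem2p2 (R : realType) (n : nat) (n_gt0 : (0 < n)%N)
    (phi : R -> R) (phi_cont : continuous phi)
    (phi_nonconst : ~ exists c : R, forall x : R, phi x = c)
    (phi_m phi_p : R)
    (phi_cvgm : phi x @[x --> -oo] --> phi_m)
    (phi_cvgp : phi x @[x --> +oo] --> phi_p) :
  (phi_m = phi_p ->
     uniform_closure (neural_space n phi 1) =
       uniform_closure (neural_space_infty n phi) /\
     uniform_closure (neural_space_infty n phi) =
       uniform_closure (lspan (C0_ridge R n))) /\
  (phi_m <> phi_p ->
     (uniform_closure (neural_space n phi 2) =
        uniform_closure (neural_space_infty n phi) /\
      uniform_closure (neural_space_infty n phi) =
        uniform_closure (lspan (tanh_products R n))) /\
     ((2 <= n)%N ->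
        uniform_closure (neural_space n phi 1) <>
          uniform_closure (neural_space n phi 2))).
Proof.
have lphi := cvg_end_limits phi_cvgm phi_cvgp.
rewrite !uniform_closureE; split=> [phiE|/eqP phi_neq].
  by rewrite phiE in lphi; exact: equal_limits_closures lphi phi_nonconst.
have [E1 E2] := distinct_limits_closures (n := n) phi_cont lphi phi_neq.
split=> // n2 E.
have i01 : Ordinal n_gt0 != Ordinal n2 by [].
(* Equality of the two closures would put the product of two coordinate tangents, an element of the
   tanh algebra, into the closure of the first layer. *)
apply: (tanh_product_notin i01 lphi); rewrite E E1 E2.
have H := unif_algebra_mul (@tanh_products_algebra R n)
  (tanh_products_dot (delta_mx 0 (Ordinal n_gt0)) 0)
  (tanh_products_dot (delta_mx 0 (Ordinal n2)) 0).
by apply: (set_ext H) => x; rewrite !addr0.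
Qed.
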